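(* Let $\eta\in\mathbb{C}$, $N\in\mathbb{N}^*$, and let $R_{a,b}(\lambda)=\lambda I+\eta\mathbb{P}_{a,b}$ on $\mathbb{C}^2\otimes\mathbb{C}^2$ (the rational 6-vertex $R$-matrix, $\mathbb{P}$ the permutation). Let $K\in\operatorname{End}(\mathbb{C}^2)$ with $K\neq\alpha I$ for every $\alpha\in\mathbb{C}$, let $\xi_1,\dots,\xi_N\in\mathbb{C}$ satisfy $\xi_a\neq\xi_b+r\eta$ for all $a\neq b$ and $r\in\{-1,0,1\}$, and let $T^{(K)}(\lambda)=\operatorname{tr}_{V_a}\big(K_aR_{a,N}(\lambda-\xi_N)\cdots R_{a,1}(\lambda-\xi_1)\big)$ on $\mathcal{H}=(\mathbb{C}^2)^{\otimes N}$. Set $d(\lambda)=\prod_{a=1}^N(\lambda-\xi_a)$, $a(\lambda)=d(\lambda+\eta)$, $g_a(\lambda)=\prod_{b\neq a}\frac{\lambda-\xi_b}{\xi_a-\xi_b}$. Then the set of eigenvalues of $T^{(K)}(\lambda)$ is $$\Sigma_{T^{(K)}}=\Big\{t(\lambda)=\operatorname{tr}K\prod_{a=1}^N(\lambda-\xi_a)+\sum_{a=1}^Ng_a(\lambda)x_a\ :\ (x_1,\dots,x_N)\in\Sigma_T\Big\},$$ where $\Sigma_T$ is the set of solutions $(x_1,\dots,x_N)\in\mathbb{C}^N$ of the system $$x_n\Big[\operatorname{tr}K\prod_{a=1}^N(\xi_n-\xi_a-\eta)+\sum_{a=1}^Ng_a(\xi_n-\eta)x_a\Big]=a(\xi_n)d(\xi_n-\eta)\det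 K,\qquad n=1,\dots,N.$$ Moreover $T^{(K)}(\lambda)$ has $w$-simple spectrum, and for every $t(\lambda)\in\Sigma_{T^{(K)}}$ the associated unique eigenvector $|t\rangle$, normalized by $\langle S|t\rangle=1$, satisfies $$\langle h_1,\dots,h_N|t\rangle=\prod_{n=1}^N\Big(\frac{t(\xi_n)}{a(\xi_n)}\Big)^{h_n}$$ in the covector basis $\langle h_1,\dots,h_N|:=\langle S|\prod_{a=1}^N\big(T^{(K)}(\xi_a)/a(\xi_a)\big)^{h_a}$, $(h_1,\dots,h_N)\in\{0,1\}^N$, where $\langle S|\in\mathcal{H}^*$ is any covector for which this set is a basis of $\mathcal{H}^*$.
   Context: $w$-simple spectrum means each eigenvalue function $t(\lambda)$ of the commuting family has exactly one common eigenvector up to scalar. $\operatorname{tr}_{V_a}$ is the trace over the auxiliary space $V_a\cong\mathbb{C}^2$.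
   Formalization: The hypothesis η ≠ 0 is added: for η = 0 the transfer matrix is the scalar tr K·d(λ) on a space of dimension 2^N, so w-simplicity fails, and a(ξ_n) = 0 makes the covectors and the eigenvector formula undefined. *)

(* Defs.v *)
From mathcomp Require Import all_boot all_order all_algebra.
From mathcomp Require Export complex.
From mathcomp Require Import Rstruct.
From Stdlib Require Import Reals.
Set Implicit Arguments. Unset Strict Implicit. Unset Printing Implicit Defensive.
Import Order.TTheory GRing.Theory Num.Theory.
Local Open Scope ring_scope.

Definition C : numClosedFieldType := complex Rdefinitions.R.

(* basis states of H = (C^2)^{(x)N}: spin configurations h : 'I_N -> 'I_2 *)
Definition cfg (N : nat) := {ffun 'I_N -> 'I_2}.
(* basis states of V_a (x) H: the auxiliary site is None, quantum site n is Some n *)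
Definition fcfg (N : nat) := {ffun option 'I_N -> 'I_2}.
Definition dH (N : nat) := #|{: cfg N}|.
Definition dF (N : nat) := #|{: fcfg N}|.
(* operators on H are 'M[C]_(dH N) in the basis enum (cfg N);
   vectors are 'cV[C]_(dH N), covectors 'rV[C]_(dH N) *)

Section Model.
Variables (N : nat) (eta : C) (K : 'M[C]_2) (xi : 'I_N -> C).

Definition swapcfg (p q : option 'I_N) (s : fcfg N) : fcfg N :=
  [ffun o => if o == p then s q else if o == q then s p else s o].
Definition Pop (p q : option 'I_N) : 'M[C]_(dF N) :=
  \matrix_(i, j) (((enum_val i : fcfg N) == swapcfg p q (enum_val j)) %:R).

Definition Rop (n : 'I_N) (mu : C) : 'M[C]_(dF N) :=
  mu%:M + eta *: Pop None (Some n).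

Definition Kaux : 'M[C]_(dF N) :=
  \matrix_(i, j)
    (let s : fcfg N := enum_val i in let s' : fcfg N := enum_val j in
     K (s None) (s' None) * [forall n : 'I_N, s (Some n) == s' (Some n)]%:R).

Definition monodromy (l : C) : 'M[C]_(dF N) :=
  foldr (fun n acc => Rop n (l - xi n) *m acc) 1%:M (rev (enum 'I_N)).

Definition joincfg (i : 'I_2) (s : cfg N) : fcfg N :=
  [ffun o => match o with None => i | Some m => s m end].
Definition ptrace (X : 'M[C]_(dF N)) : 'M[C]_(dH N) :=
  \matrix_(h, h') \sum_(i < 2)
     X (enum_rank (joincfg i (enum_val h : cfg N)))
       (enum_rank (joincfg i (enum_val h' : cfg N))).

Definition TK (l : C) : 'M[C]_(dH N) := ptrace (Kaux *m monodromy l).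

Definition dfun (l : C) : C := \prod_(a < N) (l - xi a).
Definition afun (l : C) : C := dfun (l + eta).
Definition gfun (a : 'I_N) (l : C) : C :=
  \prod_(b < N | b != a) ((l - xi b) / (xi a - xi b)).

Definition tfun (x : 'I_N -> C) (l : C) : C :=
  \tr K * \prod_(a < N) (l - xi a) + \sum_(a < N) gfun a l * x a.

Definition SigmaT (x : 'I_N -> C) : Prop :=
  forall n : 'I_N,
    x n * (\tr K * \prod_(a < N) (xi n - xi a - eta)
           + \sum_(a < N) gfun a (xi n - eta) * x a)
    = afun (xi n) * dfun (xi n - eta) * \det K.

Definition eigvec (v : 'cV[C]_(dH N)) (t : C -> C) : Prop :=
  v != 0 /\ forall l : C, TK l *m v = t l *: v.

Definition is_eigval (t : C -> C) : Prop := exists v, eigvec v t.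

Definition wsimple : Prop :=
  forall t : C -> C, forall v w, eigvec v t -> eigvec w t ->
    exists c : C, w = c *: v.

Definition covec (S : 'rV[C]_(dH N)) (h : cfg N) : 'rV[C]_(dH N) :=
  foldl (fun acc a =>
           iter (h a) (fun r => r *m ((afun (xi a))^-1 *: TK (xi a))) acc)
        S (enum 'I_N).

Definition covec_basis (S : 'rV[C]_(dH N)) : Prop :=
  let M : 'M[C]_(dH N) := \matrix_(i < dH N) covec S (enum_val i : cfg N) in
  row_free M /\ row_full M.

Definition pairing (u : 'rV[C]_(dH N)) (v : 'cV[C]_(dH N)) : C := (u *m v) 0 0.

End Model.

(* Main.v *)
From HB Require Import structures.
Require Import Defs.
From mathcomp Require Import all_boot all_order all_algebra.
From mathcomp Require Import ring zify.
From Stdlib Require Import FunctionalExtensionality.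
Set Implicit Arguments. Unset Strict Implicit. Unset Printing Implicit Defensive.
Import Order.TTheory GRing.Theory Num.Theory.
Local Open Scope ring_scope.

(** The operators T(xi_a) commute by the RTT relation, and fusion gives
    T(xi_n) T(xi_n - eta) = a(xi_n) d(xi_n - eta) det K; since T is a polynomial
    of degree N in lambda whose coefficient of lambda^N is tr K, an eigenvalue is
    determined by its values at the xi_n, which solve the quadratic system.
    Conversely, given a covector S for which the <h| form a basis, a solution x
    defines |t> by its coordinates.  On <h| the operator T(lambda) is known at the
    N distinct points xi_n - h_n eta (it raises h_n from 0 to 1, or lowers it from
    1 to 0 by fusion), so comparing polynomials shows that |t> is an eigenvector.

    Existence of S: a similarity of K, implemented on H by g^{(x)N}, makes the
    entry K_01 nonzero.  For S the all-zero configuration, the part of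
    <S|prod T(xi_a)^{h_a} with the largest number of magnons is
    <S|prod (K_01 B(xi_a))^{h_a}, and these off-shell Bethe covectors are shown
    independent by removing one site at a time. *)

(** * Tensor-product operators *)

Section Tensor.
Variables (F : fieldType) (N : nat).
Implicit Types (f : 'I_N -> 'M[F]_2) (h : cfg N) (n m : 'I_N) (c : 'M[F]_2).

Lemma sum_cfg (V : nmodType) (f : cfg N -> V) :
  \sum_(k < dH N) f (enum_val k) = \sum_(h : cfg N) f h.
Proof.
rewrite [RHS](reindex (enum_val : 'I_(dH N) -> cfg N)) //=.
by apply: onW_bij; apply: enum_val_bij.
Qed.

Definition tensor f : 'M[F]_(dH N) :=
  \matrix_(i, j) \prod_n f n ((enum_val i : cfg N) n) ((enum_val j : cfg N) n).

Lemma tensorE f i j : tensor f i j =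
  \prod_n f n ((enum_val i : cfg N) n) ((enum_val j : cfg N) n).
Proof. by rewrite mxE. Qed.

Lemma eq_tensor f g : f =1 g -> tensor f = tensor g.
Proof. by move=> e; apply/matrixP=> i j; rewrite !tensorE; apply: eq_bigr=> n _; rewrite e. Qed.

Lemma tensorM f g : tensor f *m tensor g = tensor (fun n => f n *m g n).
Proof.
apply/matrixP=> i j; rewrite mxE tensorE.
under [LHS]eq_bigr => k _ do rewrite !tensorE -big_split /=.
rewrite (sum_cfg (fun h : cfg N => \prod_n (f n ((enum_val i : cfg N) n) (h n)
   * g n (h n) ((enum_val j : cfg N) n)))).
rewrite -(bigA_distr_bigA (fun n k => f n ((enum_val i : cfg N) n) k
   * g n k ((enum_val j : cfg N) n))).
by apply: eq_bigr=> n _; rewrite mxE.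
Qed.

Lemma prod_eq h h' : \prod_n ((h n == h' n)%:R : F) = (h == h')%:R.
Proof.
have [->|ne] := eqVneq h h'; first by rewrite big1 // => n _; rewrite eqxx.
have [n nh|a] := pickP (fun n => h n != h' n).
  by rewrite (bigD1 n) //= (negbTE nh) mul0r.
by case/eqP: ne; apply/ffunP=> n; apply/eqP; move/negbFE: (a n).
Qed.

Lemma tensor1 : tensor (fun=> 1%:M) = 1%:M.
Proof.
apply/matrixP=> i j; rewrite !mxE.
under eq_bigr do rewrite mxE.
by rewrite prod_eq (inj_eq enum_val_inj).
Qed.

Definition site n c := tensor (fun m => if m == n then c else 1%:M).

Lemma siteE n c i j : site n c i j =
  c ((enum_val i : cfg N) n) ((enum_val j : cfg N) n)
  * \prod_(m | m != n) ((enum_val i : cfg N) m == (enum_val j : cfg N) m)%:R.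
Proof.
rewrite tensorE (bigD1 n) //= eqxx; congr (_ * _).
by apply: eq_bigr=> m /negbTE ->; rewrite mxE.
Qed.

Lemma siteM n c c' : site n c *m site n c' = site n (c *m c').
Proof. by rewrite tensorM; apply: eq_tensor=> m; case: eqP; rewrite ?mulmx1. Qed.

Lemma site_comm n m c c' : n != m ->
  site n c *m site m c' = site m c' *m site n c.
Proof.
move=> nm; rewrite !tensorM; apply: eq_tensor=> k.
by case: (eqVneq k n) => [->|_]; rewrite ?(negbTE nm) !(mulmx1, mul1mx).
Qed.

Lemma site_is_linear n : linear (site n).
Proof.
move=> a c c'; apply/matrixP=> i j; rewrite [RHS]mxE [X in _ = X + _]mxE !siteE 2!mxE.
by rewrite mulrDl mulrA.
Qed.
HB.instance Definition _ n :=
  GRing.isLinear.Build F 'M[F]_2 'M[F]_(dH N) _ (site n) (site_is_linear n).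

Lemma siteD n c c' : site n (c + c') = site n c + site n c'. Proof. exact: linearD. Qed.
Lemma siteB n c c' : site n (c - c') = site n c - site n c'. Proof. exact: linearB. Qed.
Lemma siteZ n a c : site n (a *: c) = a *: site n c. Proof. exact: linearZ. Qed.
Lemma site0 n : site n 0 = 0. Proof. exact: linear0. Qed.

Lemma site1 n : site n 1%:M = 1%:M.
Proof. by rewrite -tensor1; apply: eq_tensor=> m; rewrite if_same. Qed.

Lemma site_conj n (g g' : 'M[F]_2) c : g *m g' = 1%:M ->
  tensor (fun=> g) *m site n c *m tensor (fun=> g') = site n (g *m c *m g').
Proof.
by move=> e; rewrite !tensorM; apply: eq_tensor=> m; case: eqP; rewrite ?mulmx1.
Qed.

Definition magnons h : nat := (\sum_n h n)%N.

(** A nonzero entry has row state [i] and column state [j] at site [n] and equal states elsewhere.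
    This conservation law is the source of the magnon grading. *)
Lemma site_delta_magnons n (i j : 'I_2) k l : site n (delta_mx i j) k l != 0 ->
  (magnons (enum_val l) + i = magnons (enum_val k) + j)%N.
Proof.
rewrite siteE mxE.
case: (eqVneq ((enum_val k : cfg N) n) i) => [ei|_]; last by rewrite mul0r eqxx.
case: (eqVneq ((enum_val l : cfg N) n) j) => [ej|_] /=; last by rewrite mul0r eqxx.
rewrite mul1r.
move=> p; rewrite /magnons !(bigD1 (P := predT) n) //= ei ej.
rewrite (eq_bigr (fun m => (enum_val k : cfg N) m : nat)); first by rewrite -addnA addnC; lia.
move=> m mn; move: p; rewrite (bigD1 m) //= mulf_eq0 negb_or => /andP[].
by case: (eqVneq ((enum_val k : cfg N) m) ((enum_val l : cfg N) m)) => [-> | _]; rewrite ?eqxx.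
Qed.

Lemma site_scalar n a : site n a%:M = a%:M.
Proof. by rewrite -scalemx1 siteZ site1 scalemx1. Qed.

End Tensor.

(** * Two-by-two block matrices of operators: RTT relation and quantum determinant *)

Section BlockMatrices.
Variables (F : fieldType) (D : nat) (eta : F).
Local Notation block := ('I_2 -> 'I_2 -> 'M[F]_D).
Implicit Types X Y : block.

Definition bmul X Y : block := fun i j => \sum_p X i p *m Y p j.

Definition bcomm X Y := forall i j k l, X i j *m Y k l = Y k l *m X i j.

(** The components of R X_1 X'_2 = X'_2 X_1 R with R = x + eta P on two auxiliary spaces. *)
Definition rtt (x : F) X X' := forall i j k l,
  x *: (X i j *m X' k l) + eta *: (X k j *m X' i l) =
  x *: (X' k l *m X i j) + eta *: (X' k j *m X i l).

(** The Levi-Civita sign: [eps 0 1 = 1], [eps 1 0 = -1], and zero on the diagonal. *)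
Definition eps (i k : 'I_2) : F := k%:R - i%:R.

(** The components of X_1 X'_2 (1 - P) = d (1 - P), since 1 - P has the entries
    [eps i k * eps p q]. *)
Definition has_qdet (d : F) X X' := forall i k p q,
  X i p *m X' k q - X i q *m X' k p = (eps i k * eps p q * d)%:M.

(** [X_1 X'_2] has its image in the antisymmetric part of the two auxiliary spaces. *)
Definition row_antisym X X' := forall i j k l,
  X i j *m X' k l = eps i k *: (X 0 j *m X' 1 l).

Lemma bmulM X X' Y Y' i j k l : bcomm Y X' ->
  bmul X Y i j *m bmul X' Y' k l =
  \sum_p \sum_q (X i p *m X' k q) *m (Y p j *m Y' q l).
Proof.
move=> c; rewrite mulmx_suml; apply: eq_bigr=> p _.
rewrite mulmx_sumr; apply: eq_bigr=> q _.
by rewrite -!mulmxA; congr (_ *m _); rewrite !mulmxA c.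
Qed.

(** As [Y] commutes with [X'] and [Y'] with [X], the product splits into the pairs (X, X') and (Y,
    Y'), and R is moved past one pair after the other. *)
Lemma rtt_bmul x X X' Y Y' : bcomm Y X' -> bcomm Y' X ->
  rtt x X X' -> rtt x Y Y' -> rtt x (bmul X Y) (bmul X' Y').
Proof.
move=> c c' rX rY i j k l; rewrite !bmulM // [X in _ = x *: X + _]exchange_big /=.
rewrite !scaler_sumr -!big_split /=.
transitivity (\sum_p \sum_q
   (x *: (X' k q *m X i p) + eta *: (X' k p *m X i q)) *m (Y p j *m Y' q l)).
  apply: eq_bigr=> p _; rewrite !scaler_sumr -big_split; apply: eq_bigr=> q _ /=.
  by rewrite -rX mulmxDl -!scalemxAl.
transitivity (\sum_p \sum_q
   (X' k q *m X i p) *m (x *: (Y p j *m Y' q l) + eta *: (Y q j *m Y' p l))).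
  under eq_bigr => p _ do under eq_bigr => q _ do rewrite mulmxDl -!scalemxAl.
  under [RHS]eq_bigr => p _ do under eq_bigr => q _ do rewrite mulmxDr -!scalemxAr.
  under eq_bigr => p _ do rewrite big_split.
  under [RHS]eq_bigr => p _ do rewrite big_split.
  rewrite !big_split /=; congr (_ + _); exact: exchange_big.
under [LHS]eq_bigr => p _ do under eq_bigr => q _ do rewrite rY mulmxDr -!scalemxAr.
under [LHS]eq_bigr => p _ do rewrite big_split.
rewrite !big_split /=; congr (_ + _); first by apply: eq_bigr => p _; rewrite scaler_sumr.
by rewrite exchange_big; apply: eq_bigr => p _; rewrite scaler_sumr.
Qed.

Lemma eps_diag i : eps i i = 0. Proof. exact: subrr. Qed.
Lemma eps01 : eps 0 1 = 1. Proof. by rewrite /eps subr0. Qed.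
Lemma eps10 : eps 1 0 = -1. Proof. by rewrite /eps sub0r. Qed.

Lemma sum2 (V : nmodType) (f : 'I_2 -> V) : \sum_p f p = f 0 + f 1.
Proof. by rewrite big_ord_recl big_ord1; congr (_ + f _); apply/val_inj. Qed.

(** The relation for [Y] leaves a scalar containing [eps p q], so only the terms (0, 1) and (1, 0)
    survive; they recombine into the relation for [X]. *)
Lemma qdet_bmul d d' X X' Y Y' : bcomm Y X' ->
  has_qdet d X X' -> has_qdet d' Y Y' -> has_qdet (d * d') (bmul X Y) (bmul X' Y').
Proof.
move=> c qX qY i k j l; rewrite !bmulM // -sumrB.
transitivity (\sum_p \sum_q (X i p *m X' k q) *m (eps p q * eps j l * d')%:M).
  apply: eq_bigr=> p _; rewrite -sumrB; apply: eq_bigr=> q _.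
  by rewrite -mulmxBr qY.
rewrite !sum2 !eps_diag !mul0r raddf0 !mulmx0 add0r addr0 eps01 eps10.
rewrite !mulN1r !mul1r mulNr raddfN /= mulmxN -mulmxBl qX eps01 mulr1.
by rewrite -scalar_mxM; congr (_%:M); rewrite mulrACA [d * _]mulrC -!mulrA.
Qed.

(** The image of Y_1 Y'_2 is antisymmetric, and on antisymmetric vectors X_1 X'_2 acts as the scalar
    [d]. *)
Lemma row_antisym_bmull d X X' Y Y' : bcomm Y X' ->
  has_qdet d X X' -> row_antisym Y Y' -> row_antisym (bmul X Y) (bmul X' Y').
Proof.
move=> c qX aY.
have e i j k l : bmul X Y i j *m bmul X' Y' k l = (eps i k * d) *: (Y 0 j *m Y' 1 l).
  rewrite bmulM // !sum2.
  rewrite (aY 0 j 0) (aY 1 j 1) (aY 1 j 0) !eps_diag eps10 !scale0r !mulmx0 add0r addr0.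
  by rewrite scaleN1r mulmxN -mulmxBl qX eps01 mulr1 mul_scalar_mx.
by move=> i j k l; rewrite !e eps01 mul1r scalerA.
Qed.

Lemma row_antisym_bmulr X X' Y Y' : bcomm Y X' ->
  row_antisym X X' -> row_antisym (bmul X Y) (bmul X' Y').
Proof.
move=> c aX i j k l; rewrite !bmulM // scaler_sumr; apply: eq_bigr => p _.
by rewrite scaler_sumr; apply: eq_bigr => q _; rewrite aX -scalemxAl.
Qed.

End BlockMatrices.

Lemma ord2P (i : 'I_2) : i = 0 \/ i = 1.
Proof. by case: i => [[|[|?]] ?] //; [left|right]; apply/val_inj. Qed.

(** * The one-site operator *)

Section Lax.
Variables (F : fieldType) (eta : F).

(** The block [(i, j)] of [mu + eta P] on one site, as [P] is the sum of the [e_ij (x) e_ji]. *)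
Definition lax (mu : F) (i j : 'I_2) : 'M[F]_2 := (mu *+ (i == j))%:M + eta *: delta_mx j i.

Lemma lax_mul l m i j k p : lax l i j *m lax m k p =
  (l * m * (i == j)%:R * (k == p)%:R) *: 1%:M + (l * eta * (i == j)%:R) *: delta_mx p k
  + (m * eta * (k == p)%:R) *: delta_mx j i + (eta ^+ 2 * (i == p)%:R) *: delta_mx j k.
Proof.
rewrite /lax -[l *+ _]mulr_natr -[m *+ _]mulr_natr -![(_ * _)%:M]scalemx1.
rewrite !(mulmxDl, mulmxDr) -!(scalemxAl, scalemxAr) !mul1mx !mulmx1 mul_delta_mx_cond.
rewrite -[delta_mx j k *+ _]scaler_nat !scalerA !addrA.
by congr (_ *: _ + _ *: _ + _ *: _ + _ *: _); ring.
Qed.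

Lemma lax_rtt l m : rtt eta (l - m) (lax l) (lax m).
Proof.
move=> i j k p; rewrite !lax_mul.
move: (1%:M : 'M[F]_2) (delta_mx j i : 'M[F]_2) (delta_mx p k : 'M[F]_2)
  (delta_mx j k : 'M[F]_2) (delta_mx p i : 'M[F]_2) => e0 e1 e2 e3 e4.
by apply/matrixP => a b; rewrite !mxE; ring.
Qed.

Lemma lax_qdet mu : has_qdet ((mu + eta) * (mu - eta)) (lax mu) (lax (mu - eta)).
Proof.
move=> i j k p; apply/matrixP=> a b; rewrite /eps !mxE !big_ord_recl !big_ord0 !mxE.
case: (ord2P i) (ord2P j) (ord2P k) (ord2P p) (ord2P a) (ord2P b) => -> [] -> [] -> [] -> [] -> [] ->;
 rewrite /eq_op /= ?mulr1n ?mulr0n; ring.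
Qed.

(** With q the quantum site, P_1q P_2q = P_12 P_1q turns eta P_1q (eta P_2q - eta) into eta^2 (P_12
    - 1) P_1q, whose image is antisymmetric. *)
Lemma lax_antisym : row_antisym (lax 0) (lax (- eta)).
Proof.
move=> i j k p; rewrite !lax_mul.
case: (ord2P i) (ord2P k) (ord2P p) => -> [] -> [] ->;
  by apply/matrixP => a b; rewrite /eps !mxE /= ?modn_small //; ring.
Qed.
End Lax.

(** * Monodromy and transfer matrix *)

Section Chain.
Variables (F : fieldType) (N : nat) (eta : F) (xi : 'I_N -> F).
Implicit Types (s : seq 'I_N) (n : 'I_N).

Definition Lop n mu : 'I_2 -> 'I_2 -> 'M[F]_(dH N) := fun i j => site n (lax eta mu i j).

Definition chain s l : 'I_2 -> 'I_2 -> 'M[F]_(dH N) :=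
  foldr (fun n acc => bmul (Lop n (l - xi n)) acc) (fun i j => (i == j)%:R%:M) s.

Lemma chain_cons n s l : chain (n :: s) l = bmul (Lop n (l - xi n)) (chain s l).
Proof. by []. Qed.

Lemma chain_site_comm s n c l i j : n \notin s ->
  chain s l i j *m site n c = site n c *m chain s l i j.
Proof.
elim: s i j => [|m s IH] i j /=; first by rewrite scalar_mxC.
rewrite inE negb_or => /andP[nm ns]; rewrite /bmul mulmx_suml mulmx_sumr.
by apply: eq_bigr => p _; rewrite -mulmxA IH // !mulmxA /Lop site_comm // eq_sym.
Qed.

Lemma Lop_chain_comm n s mu l : n \notin s -> bcomm (chain s l) (Lop n mu).
Proof. by move=> ns i j k p; apply: chain_site_comm. Qed.

Lemma Lop_rtt n l m : rtt eta (l - m) (Lop n (l - xi n)) (Lop n (m - xi n)).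
Proof.
have -> : l - m = (l - xi n) - (m - xi n) by ring.
by move=> i j k p; rewrite !siteM -!siteZ -!siteD lax_rtt.
Qed.

Lemma Lop_qdet n mu : has_qdet ((mu + eta) * (mu - eta)) (Lop n mu) (Lop n (mu - eta)).
Proof.
by move=> i j k p; rewrite !siteM -siteB lax_qdet site_scalar.
Qed.

Lemma Lop_antisym n : row_antisym (Lop n 0) (Lop n (- eta)).
Proof. by move=> i j k p; rewrite !siteM lax_antisym siteZ. Qed.

Lemma chain_rtt s l m : uniq s -> rtt eta (l - m) (chain s l) (chain s m).
Proof.
elim: s => [_ i j k p|n s IH /= /andP[ns us]].
  by rewrite /= [_%:M *m (k == p)%:R%:M]scalar_mxC.
apply: rtt_bmul; try exact: Lop_chain_comm; last exact: IH.
exact: Lop_rtt.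
Qed.

Lemma chain_qdet s l : uniq s ->
  has_qdet (\prod_(n <- s) ((l - xi n + eta) * (l - xi n - eta))) (chain s l) (chain s (l - eta)).
Proof.
elim: s => [_ i k p q|n s IH /= /andP[ns us]].
  rewrite /= big_nil -!scalar_mxM -raddfB /eps; congr (_%:M).
  by case: i k p q => [[|[|?]] ?] [[|[|?]] ?] [[|[|?]] ?] [[|[|?]] ?] //; rewrite /eq_op /=; ring.
rewrite big_cons; apply: qdet_bmul; try exact: Lop_chain_comm; last exact: IH.
by rewrite [l - eta - _]addrAC; apply: Lop_qdet.
Qed.

(** Site [n] is the one whose local parameter is 0 here, so it makes the image antisymmetric. The
    factors to its left preserve this by their quantum determinant, and those to its right cannot
    affect the row indices. *)
Lemma chain_antisym s n : uniq s -> n \in s ->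
  row_antisym (chain s (xi n)) (chain s (xi n - eta)).
Proof.
elim: s => [//|m s IH /= /andP[ms us]]; rewrite inE.
have [-> _|nm /= ns] := eqVneq n m.
  apply: row_antisym_bmulr; first exact: Lop_chain_comm.
  by rewrite addrAC subrr add0r; apply: Lop_antisym.
apply: row_antisym_bmull (IH us ns); first exact: Lop_chain_comm.
by rewrite [xi n - eta - _]addrAC; apply: Lop_qdet.
Qed.

End Chain.

(** * Twisted trace over the auxiliary space *)

Section Twist.
Variables (F : fieldType) (D : nat) (eta : F) (K : 'M[F]_2).
Local Notation block := ('I_2 -> 'I_2 -> 'M[F]_D).
Implicit Types X Y : block.

(** This is the trace of K X over the auxiliary space, hence the transposed indices of [K]. *)
Definition twist X : 'M[F]_D := \sum_(p : 'I_2 * 'I_2) K p.2 p.1 *: X p.1 p.2.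

Lemma twistE X : twist X = K 0 0 *: X 0 0 + K 1 0 *: X 0 1 + (K 0 1 *: X 1 0 + K 1 1 *: X 1 1).
Proof.
by rewrite /twist -(pair_bigA _ (fun i j => K j i *: X i j)) /= !sum2.
Qed.

Lemma twistM X X' : twist X *m twist X' =
  \sum_(p : 'I_2 * 'I_2) \sum_(q : 'I_2 * 'I_2)
    (K p.2 p.1 * K q.2 q.1) *: (X p.1 p.2 *m X' q.1 q.2).
Proof.
rewrite mulmx_suml; apply: eq_bigr => p _; rewrite mulmx_sumr; apply: eq_bigr => q _.
by rewrite -scalemxAl -scalemxAr scalerA.
Qed.

(** The relation [r], and [r] with [i] and [k] exchanged, contracted with [K (x) K], give
    [x d = - eta q] and [eta d = - x q] for the commutator [d] and the same [q]. *)
Lemma twist_comm x X X' : rtt eta x X X' -> eta ^+ 2 != x ^+ 2 ->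
  twist X *m twist X' = twist X' *m twist X.
Proof.
move=> r ne.
pose P := \sum_(p : 'I_2 * 'I_2) \sum_(q : 'I_2 * 'I_2)
    (K p.2 p.1 * K q.2 q.1) *: (X q.1 p.2 *m X' p.1 q.2).
pose P' := \sum_(p : 'I_2 * 'I_2) \sum_(q : 'I_2 * 'I_2)
    (K p.2 p.1 * K q.2 q.1) *: (X' q.1 p.2 *m X p.1 q.2).
have swap : twist X' *m twist X = \sum_(p : 'I_2 * 'I_2) \sum_(q : 'I_2 * 'I_2)
    (K p.2 p.1 * K q.2 q.1) *: (X' q.1 q.2 *m X p.1 p.2).
  by rewrite twistM exchange_big; do 2![apply: eq_bigr => ? _]; rewrite mulrC.
have swapP' : P' = \sum_(p : 'I_2 * 'I_2) \sum_(q : 'I_2 * 'I_2)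
    (K p.2 p.1 * K q.2 q.1) *: (X' p.1 q.2 *m X q.1 p.2).
  by rewrite /P' exchange_big; do 2![apply: eq_bigr => ? _]; rewrite mulrC.
have e1 : x *: (twist X *m twist X') + eta *: P = x *: (twist X' *m twist X) + eta *: P'.
  rewrite twistM swap !scaler_sumr -!big_split; apply: eq_bigr => p _ /=.
  rewrite !scaler_sumr -!big_split; apply: eq_bigr => q _ /=.
  by rewrite !scalerA ![_ * (_ * _)]mulrC -!scalerA -!scalerDr r.
have e2 : x *: P + eta *: (twist X *m twist X') = x *: P' + eta *: (twist X' *m twist X).
  rewrite !twistM swapP' !scaler_sumr -!big_split; apply: eq_bigr => p _ /=.
  rewrite !scaler_sumr -!big_split; apply: eq_bigr => q _ /=.
  by rewrite !scalerA ![_ * (_ * _)]mulrC -!scalerA -!scalerDr r.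
apply/eqP; rewrite -subr_eq0; set d := _ - _.
have f1 : x *: d = - (eta *: (P - P')).
  apply/eqP; rewrite -addr_eq0 /d !scalerBr addrACA e1 -opprD subrr //.
have f2 : eta *: d = - (x *: (P - P')).
  apply/eqP; rewrite -addr_eq0 /d !scalerBr addrC addrACA e2 -opprD subrr //.
have : (eta ^+ 2 - x ^+ 2) *: d = 0.
  rewrite scalerBl !expr2 -!scalerA f1 f2 !scalerN !scalerA [x * eta]mulrC subrr //.
by move/eqP; rewrite scaler_eq0 subr_eq0 (negbTE ne).
Qed.

Lemma det_mx2 : \det K = K 0 0 * K 1 1 - K 0 1 * K 1 0.
Proof.
rewrite (expand_det_row _ 0) sum2 /cofactor !det_mx11 !mxE /= expr0 expr1 !mul1r mulN1r mulrN.
by congr (_ * K _ _ - _ * K _ _); apply/val_inj.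
Qed.

(** Antisymmetry in the rows reduces K (x) K to its action on the antisymmetric line, which is
    [\det K]; the remaining combination of columns is the quantum determinant [d]. *)
Lemma twist_fusion d X X' : row_antisym X X' -> has_qdet d X X' ->
  twist X *m twist X' = (\det K * d)%:M.
Proof.
move=> a q.
have qd : d%:M = X 0 0 *m X' 1 1 - X 0 1 *m X' 1 0.
  by rewrite q !eps01 !mul1r.
rewrite scalar_mxM mul_scalar_mx qd det_mx2 !twistE.
rewrite !(mulmxDl, mulmxDr) -!scalemxAl -!scalemxAr.
rewrite !(a 0 _ 0) !(a 1 _ 1) !(a 1 _ 0) !eps_diag eps10.
apply/matrixP => i j; move: (X 0 0 *m X' 1 1) (X 0 0 *m X' 1 0) (X 0 1 *m X' 1 1) (X 0 1 *m X' 1 0) => Y1 Y2 Y3 Y4.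
rewrite !mxE; ring.
Qed.
End Twist.

(** * Transfer matrix: commutation and fusion *)

Section Transfer.
Variables (F : fieldType) (N : nat) (eta : F) (K : 'M[F]_2) (xi : 'I_N -> F).

Definition sites : seq 'I_N := rev (enum 'I_N).

Lemma sites_uniq : uniq sites.
Proof. by rewrite rev_uniq enum_uniq. Qed.

Lemma mem_sites n : n \in sites.
Proof. by rewrite mem_rev mem_enum. Qed.

Lemma prod_sites (f : 'I_N -> F) : \prod_(n <- sites) f n = \prod_n f n.
Proof.
rewrite /sites (perm_big (enum 'I_N)) ?big_enum //.
by rewrite perm_rev.
Qed.

Definition transfer l : 'M[F]_(dH N) := twist K (chain eta xi sites l).

Lemma transfer_comm l m : eta ^+ 2 != (l - m) ^+ 2 ->
  transfer l *m transfer m = transfer m *m transfer l.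
Proof. exact/twist_comm/chain_rtt/sites_uniq. Qed.

Lemma transfer_fusion n :
  transfer (xi n) *m transfer (xi n - eta) =
  (\det K * (\prod_a (xi n - xi a + eta) * \prod_a (xi n - xi a - eta)))%:M.
Proof.
rewrite -big_split -prod_sites; apply: twist_fusion.
  by apply: chain_antisym; rewrite ?sites_uniq ?mem_sites.
exact/chain_qdet/sites_uniq.
Qed.

End Transfer.

(** * Blocks of the auxiliary space *)

Section AuxiliaryBlocks.
Variables (F : fieldType) (N : nat).
Implicit Types X Y : 'M[F]_(dF N).

Definition aux_block i j X : 'M[F]_(dH N) :=
  \matrix_(h, h') X (enum_rank (joincfg i (enum_val h : cfg N)))
                    (enum_rank (joincfg j (enum_val h' : cfg N))).

Definition restrict_cfg (s : fcfg N) : cfg N := [ffun n => s (Some n)].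

Lemma joincfgK i (s : cfg N) : restrict_cfg (joincfg i s) = s.
Proof. by apply/ffunP => n; rewrite !ffunE. Qed.

Lemma joincfg_None i (s : cfg N) : joincfg i s None = i.
Proof. by rewrite ffunE. Qed.

Lemma restrict_cfgK (s : fcfg N) : joincfg (s None) (restrict_cfg s) = s.
Proof. by apply/ffunP => -[n|]; rewrite !ffunE. Qed.

Lemma eq_joincfg i j (s s' : cfg N) : (joincfg i s == joincfg j s') = (i == j) && (s == s').
Proof.
apply/eqP/andP => [e|[/eqP-> /eqP->//]].
by rewrite -(joincfg_None i s) e joincfg_None -(joincfgK i s) e joincfgK.
Qed.

Lemma aux_blockM i j X Y :
  aux_block i j (X *m Y) = \sum_p aux_block i p X *m aux_block p j Y.
Proof.
apply/matrixP => a b; rewrite summxE mxE.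
rewrite mxE; under [RHS]eq_bigr => p _ do rewrite mxE.
rewrite pair_bigA /= (reindex (fun q : 'I_2 * 'I_(dH N) =>
  enum_rank (joincfg q.1 (enum_val q.2 : cfg N)))) /=.
  by apply: eq_bigr => q _; rewrite !mxE.
exists (fun k => ((enum_val k : fcfg N) None, enum_rank (restrict_cfg (enum_val k)))) => /= [[p h]|k] _ /=.
  by rewrite enum_rankK joincfgK enum_valK joincfg_None.
by rewrite enum_rankK restrict_cfgK enum_valK.
Qed.

Lemma aux_blockD i j X Y : aux_block i j (X + Y) = aux_block i j X + aux_block i j Y.
Proof. by apply/matrixP => a b; rewrite !mxE. Qed.

Lemma aux_blockZ i j c X : aux_block i j (c *: X) = c *: aux_block i j X.
Proof. by apply/matrixP => a b; rewrite !mxE. Qed.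

Lemma aux_block_scalar i j c : aux_block i j c%:M = (c *+ (i == j))%:M.
Proof.
apply/matrixP => a b; rewrite !mxE (inj_eq enum_rank_inj) eq_joincfg (inj_eq enum_val_inj).
by rewrite -mulnb mulrnA.
Qed.

(** The operator [Pop None (Some n)] over a general field; over [C] the two agree by conversion. *)
Definition permutation n : 'M[F]_(dF N) :=
  \matrix_(i, j) ((enum_val i : fcfg N) == swapcfg None (Some n) (enum_val j))%:R.

Lemma aux_block_permutation i j n :
  aux_block i j (permutation n) = site n (delta_mx j i).
Proof.
apply/matrixP => a b; rewrite mxE siteE mxE !enum_rankK [in RHS]mxE -natr_prod -natrM; congr (_%:R).
set s : cfg N := enum_val a; set s' : cfg N := enum_val b.
have swapE m : swapcfg None (Some n) (joincfg j s') (Some m) = if m == n then j else s' m.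
  by rewrite !ffunE (inj_eq (@Some_inj _)).
(* Both sides vanish unless the two configurations agree away from [n]. *)
have [/forallP off|] := boolP [forall m, (m != n) ==> (s m == s' m)]; last first.
  rewrite negb_forall => /existsP[m]; rewrite negb_imply => /andP[mn ne].
  rewrite (bigD1 m) //= (negbTE ne) mul0n muln0.
  case: eqP => // /ffunP/(_ (Some m)); rewrite swapE (negbTE mn) ffunE => e.
  by rewrite e eqxx in ne.
rewrite big1 ?muln1 => [|m mn]; last by rewrite (implyP (off m) mn).
congr nat_of_bool; apply/eqP/andP => [/ffunP e | [/eqP sn /eqP s'n]].
  have := e None; rewrite !ffunE /= => ->; rewrite eqxx.
  by have := e (Some n); rewrite swapE eqxx ffunE => ->; rewrite eqxx.
apply/ffunP => -[m|]; last by rewrite !ffunE.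
rewrite swapE ffunE; case: (eqVneq m n) => [->//|mn].
exact/eqP/(implyP (off m)).
Qed.

Definition twist_op (K : 'M[F]_2) : 'M[F]_(dF N) :=
  \matrix_(i, j)
    (let s : fcfg N := enum_val i in let s' : fcfg N := enum_val j in
     K (s None) (s' None) * [forall n : 'I_N, s (Some n) == s' (Some n)]%:R).

Lemma aux_block_twist_op K i j : aux_block i j (twist_op K) = (K i j)%:M.
Proof.
apply/matrixP => a b; rewrite !mxE /= !enum_rankK !joincfg_None mulr_natr; congr (_ *+ nat_of_bool _).
rewrite -(inj_eq enum_val_inj); apply/forallP/eqP => [e | e n].
  by apply/ffunP => n; have /eqP := e n; rewrite !ffunE.
by rewrite !ffunE e.
Qed.

End AuxiliaryBlocks.

Lemma aux_block_Rop N eta n mu i j :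
  aux_block i j (Rop eta n mu : 'M_(dF N)) = Lop eta n mu i j.
Proof.
rewrite /Lop /lax siteD siteZ site_scalar.
rewrite -(aux_block_permutation C i j n) -aux_block_scalar -aux_blockZ -aux_blockD.
by [].
Qed.

Lemma aux_block_monodromy N eta (xi : 'I_N -> C) l i j :
  aux_block i j (monodromy eta xi l) = chain eta xi (sites N) l i j.
Proof.
rewrite /monodromy -/(sites N); elim: (sites N) i j => [|n s IH] i j /=.
  exact: (@aux_block_scalar C N i j 1).
by rewrite aux_blockM; apply: eq_bigr => p _; rewrite IH aux_block_Rop.
Qed.

Lemma TK_transfer N eta K (xi : 'I_N -> C) l : TK eta K xi l = transfer eta K xi l.
Proof.
have -> : TK eta K xi l = \sum_i aux_block i i (twist_op N K *m monodromy eta xi l).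
  by apply/matrixP => a b; rewrite summxE mxE; apply: eq_bigr => i _; rewrite [RHS]mxE.
rewrite /transfer /twist -(pair_bigA _ (fun i j => K j i *: chain eta xi (sites N) l i j)) exchange_big /=.
apply: eq_bigr => i _; rewrite aux_blockM; apply: eq_bigr => p _.
by rewrite aux_block_twist_op mul_scalar_mx aux_block_monodromy.
Qed.

(** * The separating covector *)

Section OrderedProducts.
Variables (F : fieldType) (D : nat) (I : eqType).
Implicit Types (Y Z : I -> 'M[F]_D) (t : seq I).

Definition opprod Y t : 'M[F]_D := foldr (fun a acc => Y a *m acc) 1%:M t.

Lemma opprod_cat Y t t' : opprod Y (t ++ t') = opprod Y t *m opprod Y t'.
Proof. by elim: t => [|a t IH] /=; rewrite ?mul1mx // IH mulmxA. Qed.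

Lemma opprod_rcons Y t a : opprod Y (rcons t a) = opprod Y t *m Y a.
Proof. by rewrite -cats1 opprod_cat /= mulmx1. Qed.

Lemma opprod_comm Y X t : (forall a, a \in t -> Y a *m X = X *m Y a) ->
  opprod Y t *m X = X *m opprod Y t.
Proof.
elim: t => [|a t IH] c /=; first by rewrite mulmx1 mul1mx.
rewrite -mulmxA IH ?mulmxA ?c ?mem_head // => b bt.
by apply: c; rewrite inE bt orbT.
Qed.

(** Used with [P] a projector on one site, [Y] an operator of the chain containing that site and [Z]
    its analogue for the chain without it. *)
Lemma opprod_intertwine Y Z P (c : I -> F) t :
    (forall a, a \in t -> P *m Y a = c a *: (P *m Z a)) ->
    (forall a, a \in t -> Z a *m P = P *m Z a) ->
  P *m opprod Y t = (\prod_(a <- t) c a) *: (P *m opprod Z t).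
Proof.
elim: t => [|a t IH] e co /=; first by rewrite big_nil scale1r.
rewrite mulmxA e ?mem_head // -co ?mem_head // -scalemxAl -mulmxA IH.
- by rewrite -scalemxAr scalerA big_cons !mulmxA co ?mem_head.
- by move=> b bt; apply: e; rewrite inE bt orbT.
by move=> b bt; apply: co; rewrite inE bt orbT.
Qed.

Lemma opprod_intertwine_r Y Z P (c : I -> F) t :
    (forall a, a \in t -> Y a *m P = c a *: (P *m Z a)) ->
  opprod Y t *m P = (\prod_(a <- t) c a) *: (P *m opprod Z t).
Proof.
elim: t => [|a t IH] e /=; first by rewrite big_nil scale1r mulmx1 mul1mx.
rewrite -mulmxA IH => [|b bt]; last by apply: e; rewrite inE bt orbT.
by rewrite -scalemxAr (mulmxA (Y a)) e ?mem_head // -scalemxAl scalerA big_cons mulrC -mulmxA.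
Qed.

Lemma opprodZ Y (c : I -> F) t :
  opprod (fun a => c a *: Y a) t = (\prod_(a <- t) c a) *: opprod Y t.
Proof.
elim: t => [|a t IH] /=; first by rewrite big_nil scale1r.
by rewrite IH big_cons -scalemxAl -scalemxAr scalerA.
Qed.

Lemma perm_opprod Y t t' : (forall a b, Y a *m Y b = Y b *m Y a) ->
  perm_eq t t' -> opprod Y t = opprod Y t'.
Proof.
move=> c; elim: t t' => [|a t IH] t' p.
  by move: p => /perm_size /esym/size0nil ->.
have at' : a \in t' by rewrite -(perm_mem p) mem_head.
case/splitPr: at' p => t1 t2 p.
rewrite /= opprod_cat /= (mulmxA _ (Y a)) (@opprod_comm Y (Y a)) // -mulmxA -opprod_cat.
congr (_ *m _); apply: IH; rewrite -(perm_cons a); apply: perm_trans p _.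
by rewrite perm_sym -[_ :: _ ++ _]cat1s -[a :: t2]cat1s perm_catCA.
Qed.

End OrderedProducts.

(** * Independence of the off-shell Bethe covectors *)

Section Separation.
Variables (F : fieldType) (N : nat) (eta : F) (xi : 'I_N -> F).
Implicit Types (s : seq 'I_N) (n m : 'I_N).
Hypothesis eta0 : eta != 0.
Hypothesis xi_neq : forall a b, a != b -> xi a != xi b.
Hypothesis xi_neqD : forall a b, a != b -> xi a - xi b + eta != 0.

Local Notation chain := (chain eta xi).
Local Notation e_ i j := (delta_mx i j : 'M[F]_2).

Definition raising s l := chain s l 1 0.

(** The projector is the identity outside [s], so that in the induction on the chain the sites
    already removed stay free. *)
Definition vacuum s : 'M[F]_(dH N) := tensor (fun n => if n \in s then e_ 0 0 else 1%:M).

Lemma vacuum_cons n s : n \notin s -> vacuum (n :: s) = vacuum s *m site n (e_ 0 0).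
Proof.
move=> ns; rewrite tensorM; apply: eq_tensor => m; rewrite inE.
by case: eqVneq => [->|_]; rewrite ?(negbTE ns) ?mul1mx ?mulmx1.
Qed.

Lemma vacuum_site_comm n s c : n \notin s ->
  vacuum s *m site n c = site n c *m vacuum s.
Proof.
move=> ns; rewrite !tensorM; apply: eq_tensor => m.
by case: eqVneq => [->|_]; rewrite ?(negbTE ns) ?mul1mx ?mulmx1.
Qed.

Lemma lax10 mu : lax eta mu 1 0 = eta *: e_ 0 1.
Proof. by rewrite /lax mulr0n raddf0 add0r. Qed.
Lemma lax01 mu : lax eta mu 0 1 = eta *: e_ 1 0.
Proof. by rewrite /lax mulr0n raddf0 add0r. Qed.
Lemma lax11 mu : lax eta mu 1 1 = mu%:M + eta *: e_ 1 1.
Proof. by []. Qed.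
Lemma lax00 mu : lax eta mu 0 0 = mu%:M + eta *: e_ 0 0.
Proof. by []. Qed.

Lemma chain_cons2 n s l i j : chain (n :: s) l i j =
  site n (lax eta (l - xi n) i 0) *m chain s l 0 j +
  site n (lax eta (l - xi n) i 1) *m chain s l 1 j.
Proof. by rewrite chain_cons /bmul sum2. Qed.

(** Since e_11 e_01 = 0, only the diagonal entry of the site operator remains, and on e_11 it is the
    scalar l - xi_n + eta. *)
Lemma down_raising n s l : site n (e_ 1 1) *m raising (n :: s) l =
  (l - xi n + eta) *: (site n (e_ 1 1) *m raising s l).
Proof.
rewrite /raising chain_cons2 mulmxDr !mulmxA !siteM lax10 lax11.
rewrite mulmxDr -!scalemxAr !mul_delta_mx_cond /= mulr0n mulr1n scaler0 site0 mul0mx add0r.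
by rewrite mul_mx_scalar -scalerDl siteZ -scalemxAl.
Qed.

Lemma raising_up n s l : n \notin s -> raising (n :: s) l *m site n (e_ 0 0) =
  (l - xi n) *: (site n (e_ 0 0) *m raising s l).
Proof.
move=> ns; rewrite /raising chain_cons2 mulmxDl -!mulmxA !chain_site_comm // !mulmxA !siteM lax10 lax11.
rewrite mulmxDl -!scalemxAl !mul_delta_mx_cond /= !mulr0n !scaler0 addr0 site0 mul0mx add0r.
by rewrite mul_scalar_mx siteZ -scalemxAl.
Qed.

(** At l = xi_n the diagonal entry is eta e_11, which e_00 kills from the left; only the entry that
    flips the site survives. *)
Lemma up_raising n s : site n (e_ 0 0) *m raising (n :: s) (xi n) =
  eta *: (site n (e_ 0 1) *m chain s (xi n) 0 0).
Proof.
rewrite /raising chain_cons2 mulmxDr !mulmxA !siteM lax10 lax11 subrr raddf0 add0r.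
rewrite -!scalemxAr !mul_delta_mx_cond /= mulr0n mulr1n scaler0 site0 mul0mx addr0.
by rewrite siteZ -scalemxAl.
Qed.

Lemma vacuum_chain00 s l : uniq s -> vacuum s *m chain s l 0 0 =
  (\prod_(m <- s) (l - xi m + eta)) *: vacuum s.
Proof.
elim: s => [_|n s IH]; first by rewrite /= mulmx1 big_nil scale1r.
case/andP => ns us; rewrite vacuum_cons // chain_cons2 mulmxDr !mulmxA -!(mulmxA (vacuum s)) !siteM lax00 lax01.
rewrite mulmxDr -!scalemxAr !mul_delta_mx_cond /= mulr0n mulr1n scaler0 site0.
rewrite mul0mx mulmx0 addr0 mul_mx_scalar -scalerDl siteZ -scalemxAl -scalemxAr -chain_site_comm // mulmxA IH //.
by rewrite -scalemxAl scalerA big_cons.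
Qed.

(** Induction on the leftmost site [n] of the chain.  If [xi n] is used, [up_raising] flips this
    site to 1, where [B] acts as a multiple of the shorter [B]; this shows that the component of
    [v] with [n] in state 1 vanishes, and on the other one [raising_up] removes the site. *)
Lemma raising_separation s (v : 'cV[F]_(dH N)) : uniq s ->
    (forall b : pred 'I_N,
       vacuum s *m opprod (fun a => raising s (xi a)) (filter b s) *m v = 0) ->
  v = 0.
Proof.
elim: s v => [|n s IH] v.
  move=> _ /(_ xpredT) /=; rewrite mulmx1.
  have -> : vacuum [::] = 1%:M by rewrite -tensor1; apply: eq_tensor.
  by rewrite mul1mx.
rewrite /= => /andP[ns us] hyp.
have neqs a : a \in s -> a != n by apply: contraTneq => ->.
have filt b (c : bool) : filter (fun a => if a == n then c else b a) s = filter b s.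
  by apply: eq_in_filter => a /neqs/negbTE ->.
have scomm c t : site n c *m opprod (fun a => raising s (xi a)) t =
                 opprod (fun a => raising s (xi a)) t *m site n c.
  by apply/esym/opprod_comm => a _; apply: chain_site_comm.
have v1 : site n (e_ 1 1) *m v = 0.
  apply: IH => // b.
  (* Selecting [n] as well puts it first in the product, next to the vacuum, where [up_raising]
     applies. *)
  have := hyp (fun a => if a == n then true else b a).
  rewrite /= eqxx filt /=; set t := filter b s.
  have ts a : a \in t -> a \in s by rewrite mem_filter => /andP[].
  rewrite vacuum_cons // !mulmxA -(mulmxA (vacuum s)) up_raising.
  rewrite -scalemxAr -chain_site_comm // !mulmxA vacuum_chain00 //.
  rewrite -!scalemxAl scalerA => /eqP; rewrite scaler_eq0 mulf_eq0 (negbTE eta0) /=.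
  rewrite prodf_seq_eq0; case: hasP => [[m ms]|_ /=].
    by rewrite /= (negbTE (xi_neqD _)) // eq_sym neqs.
  (* Writing e_01 = e_01 e_11 exposes a projector on which [down_raising] strips site [n] from all
     remaining factors. *)
  have e01 : site n (e_ 0 1) = site n (e_ 0 1) *m site n (e_ 1 1).
    by rewrite siteM mul_delta_mx.
  rewrite e01 -!mulmxA (mulmxA (site n (e_ 1 1))).
  rewrite (@opprod_intertwine _ _ _ _ (fun a => raising s (xi a)) _
     (fun a => xi a - xi n + eta)); first last.
  - by move=> a _; apply: chain_site_comm.
  - by move=> a _; apply: down_raising.
  rewrite -scalemxAl -!scalemxAr scaler_eq0 prodf_seq_eq0; case: hasP => [[m mt]|_ /= /eqP z].
    by rewrite /= (negbTE (xi_neqD _)) // neqs // ts.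
  (* As e_10 e_01 = e_11, this multiplication turns the flip back into the projector, which then
     moves onto [v]. *)
  have := congr1 (mulmx (site n (e_ 1 0))) z.
  rewrite mulmx0 (mulmxA (site n (e_ 1 0))) -vacuum_site_comm // -!mulmxA.
  rewrite (mulmxA (site n (e_ 1 0))) siteM mul_delta_mx (mulmxA (site n (e_ 1 1))) siteM mul_delta_mx.
  by rewrite (mulmxA (site n (e_ 1 1))) scomm -!mulmxA.
have v0 : site n (e_ 0 0) *m v = v.
  rewrite -[RHS]mul1mx -(site1 F n).
  have -> : (1%:M : 'M[F]_2) = e_ 0 0 + e_ 1 1.
    by apply/matrixP => -[[|[|?]] ?] [[|[|?]] ?] //; rewrite !mxE /eq_op /= ?addr0 ?add0r.
  by rewrite siteD mulmxDl v1 addr0.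
apply: IH => // b.
have := hyp (fun a => if a == n then false else b a).
rewrite /= eqxx filt /=; set t := filter b s.
have ts a : a \in t -> a \in s by rewrite mem_filter => /andP[].
rewrite vacuum_cons // -{1}v0 -!mulmxA (mulmxA _ _ v).
rewrite (@opprod_intertwine_r _ _ _ _ (fun a => raising s (xi a)) _
     (fun a => xi a - xi n)); last first.
  by move=> a _; apply: raising_up.
rewrite -scalemxAl -!scalemxAr => /eqP; rewrite scaler_eq0 prodf_seq_eq0.
case: hasP => [[m mt]|_ /= /eqP]; first by rewrite /= subr_eq0 (negbTE (xi_neq _)) // neqs // ts.
by rewrite !(mulmxA (site n _)) siteM mul_delta_mx scomm -!mulmxA v0.
Qed.

End Separation.

(** * Magnon grading and the leading part of the transfer matrix *)

Section Grading.
Variables (F : fieldType) (N : nat).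
Local Notation wt k := (magnons (enum_val k : cfg N)).
Implicit Types (X Y : 'M[F]_(dH N)) (R : rel nat) (P : pred nat).

(** [R] relates the magnon numbers of the row and column indices of nonzero entries;
    covectors act from the left. *)
Definition graded R X := forall k k', ~~ R (wt k) (wt k') -> X k k' = 0.
Definition supported p P (r : 'M[F]_(p, dH N)) := forall i k, ~~ P (wt k) -> r i k = 0.

Lemma gradedM R R' R'' X Y : (forall a b c, R a b -> R' b c -> R'' a c) ->
  graded R X -> graded R' Y -> graded R'' (X *m Y).
Proof.
move=> tr gX gY k k' n; rewrite mxE big1 // => q _.
case: (boolP (R (wt k) (wt q))) => [r|/gX->]; last by rewrite mul0r.
by rewrite [Y _ _]gY ?mulr0 //; apply: contra n; apply: tr r.
Qed.

Lemma gradedD R X Y : graded R X -> graded R Y -> graded R (X + Y).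
Proof. by move=> gX gY k k' n; rewrite mxE gX ?gY ?addr0. Qed.

Lemma gradedZ R c X : graded R X -> graded R (c *: X).
Proof. by move=> gX k k' n; rewrite mxE gX ?mulr0. Qed.

Lemma graded_sub R R' X : subrel R R' -> graded R X -> graded R' X.
Proof. by move=> s gX k k' n; apply: gX; apply: contra n; apply: s. Qed.

Lemma supportedM p P P' R (r : 'M_(p, _)) X : (forall a b, P a -> R a b -> P' b) ->
  supported P r -> graded R X -> supported P' (r *m X).
Proof.
move=> tr gr gX i k n; rewrite mxE big1 // => q _.
case: (boolP (P (wt q))) => [Pq|/gr->]; last by rewrite mul0r.
by rewrite [X _ _]gX ?mulr0 //; apply: contra n; apply: tr.
Qed.

Lemma supportedD p P (r r' : 'M_(p, _)) : supported P r -> supported P r' -> supported P (r + r').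
Proof. by move=> gX gY k k' n; rewrite mxE gX ?gY ?addr0. Qed.

Lemma graded_site_delta n (i j : 'I_2) :
  graded (fun a b => b + i == a + j)%N (site n (delta_mx i j : 'M[F]_2)).
Proof.
move=> k k'; apply: contraNeq => /site_delta_magnons e.
exact/eqP.
Qed.

Variables (eta : F) (xi : 'I_N -> F).

Lemma graded_scalar c : graded (fun a b => a == b) (c%:M : 'M[F]_(dH N)).
Proof. by move=> k k' n; rewrite mxE; case: (eqVneq k k') n => [->|]; rewrite ?eqxx. Qed.

Lemma graded_Lop n mu (i j : 'I_2) : graded (fun a b => b + j == a + i)%N (Lop eta n mu i j).
Proof.
rewrite /Lop /lax siteD siteZ site_scalar; apply: gradedD; last first.
  exact/gradedZ/graded_site_delta.
case: eqVneq => [->|_]; last by rewrite mulr0n raddf0 => k k' _; rewrite mxE.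
by apply: graded_sub (graded_scalar _) => a b /eqP->.
Qed.

Lemma graded_chain s l (i j : 'I_2) : graded (fun a b => b + j == a + i)%N (chain eta xi s l i j).
Proof.
elim: s i j => [|n s IH] i j.
  rewrite /=; case: eqVneq => [->|_]; last by rewrite raddf0 => k k' _; rewrite mxE.
  by apply: graded_sub (graded_scalar _) => a b /eqP->.
rewrite chain_cons /bmul sum2; apply: gradedD;
 (apply: gradedM; [|exact: graded_Lop|exact: IH]) => a b c /eqP e /eqP e'; apply/eqP; lia.
Qed.

Variable K : 'M[F]_2.
Local Notation T := (fun a => transfer eta K xi (xi a)).
Local Notation B := (fun a => K 0 1 *: raising eta xi (sites N) (xi a)).

Definition vac_cfg : cfg N := [ffun=> 0].
Definition vac_row : 'rV[F]_(dH N) := delta_mx 0 (enum_rank vac_cfg).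

Lemma magnons_vac : magnons vac_cfg = 0%N.
Proof. by rewrite /magnons big1 // => n _; rewrite ffunE. Qed.

Lemma graded_raising s l : graded (fun a b => b == a.+1) (raising eta xi s l).
Proof.
rewrite /raising; have := @graded_chain s l 1 0.
by apply: graded_sub => a b; rewrite addn0 addn1.
Qed.

Lemma graded_lower a : graded (fun a b => b <= a)%N (T a - B a).
Proof.
rewrite /transfer twistE /raising [_ *: _ + K 1 1 *: _]addrC !addrA addrK.
apply: gradedD; [apply: gradedD|]; apply: gradedZ.
- by have := @graded_chain (sites N) (xi a) 0 0; apply: graded_sub => x y /eqP; lia.
- by have := @graded_chain (sites N) (xi a) 0 1; apply: graded_sub => x y /eqP /=; lia.
by have := @graded_chain (sites N) (xi a) 1 1; apply: graded_sub => x y /eqP /=; lia.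
Qed.

(** Over all sites the vacuum projector has rank one, so a statement about [vac_row] yields the
    hypothesis of [raising_separation]. *)
Lemma vacuum_sites : vacuum F (sites N) = col (enum_rank vac_cfg) (vacuum F (sites N)) *m vac_row.
Proof.
apply/matrixP => i k; rewrite [RHS]mxE big_ord1 !mxE eqxx /=.
have [->|nk] := eqVneq k (enum_rank vac_cfg); first by rewrite mulr1 -tensorE.
have [n nz|z] := pickP (fun n => (enum_val k : cfg N) n != 0).
  by rewrite mulr0 (bigD1 n) //= mem_sites mxE (negbTE nz) andbF mul0r.
case/eqP: nk; rewrite -[k]enum_valK; congr enum_rank; apply/ffunP => n.
by apply/eqP; rewrite ffunE; move/negbFE: (z n).
Qed.

Lemma supported_raising t :
  supported (fun a => a == size t) (vac_row *m opprod B t).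
Proof.
elim/last_ind: t => [|t a IH].
  move=> i k; rewrite /= mulmx1 !mxE.
  by case: (eqVneq k (enum_rank vac_cfg)) => [->|_]; rewrite ?andbF // enum_rankK magnons_vac.
rewrite opprod_rcons mulmxA size_rcons; apply: supportedM IH (gradedZ _ (graded_raising _ _)).
by move=> x b /eqP-> .
Qed.

(** Each factor raises the magnon number by at most one, and by exactly one only through its part
    [B a]. The leading part is therefore the product of the [B a]. *)
Lemma supported_lower t :
  supported (fun a => a < size t)%N (vac_row *m opprod T t - vac_row *m opprod B t).
Proof.
elim/last_ind: t => [|t a IH]; first by rewrite subrr => i k _; rewrite mxE.
rewrite !opprod_rcons !mulmxA size_rcons.
set r := vac_row *m _ in IH *; set b := vac_row *m opprod B t in IH *.
(* In the first term the lower-order remainder gains at most one magnon; in the second the leading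
   covector gains none. *)
have -> : r *m T a - b *m B a = (r - b) *m T a + b *m (T a - B a).
  by rewrite mulmxBl mulmxBr addrA subrK.
apply: supportedD.
  have gT : graded (fun a b => b <= a.+1)%N (T a).
    rewrite -[T a](subrK (B a)); apply: gradedD.
      by apply: graded_sub (graded_lower a) => x y; apply: leqW.
    by apply/gradedZ; apply: graded_sub (graded_raising _ _) => x y /eqP->.
  by refine (supportedM _ IH gT) => x y lt le; lia.
by refine (supportedM _ (@supported_raising t) (@graded_lower a)) => x y /eqP-> le; lia.
Qed.

Hypothesis eta0 : eta != 0.
Hypothesis xi_neq : forall a b, a != b -> xi a != xi b.
Hypothesis xi_neqD : forall a b, a != b -> xi a - xi b + eta != 0.

(** Strong induction on the number m of magnons shows that the m-magnon component of [v] vanishes. A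
    product of m operators [B a] sees only this component; it differs from the product of the [T a],
    zero on [v] by hypothesis, by a covector with fewer magnons, where [v] is already zero. Products
    of another length miss the component. *)
Lemma transfer_separation (v : 'cV[F]_(dH N)) : K 0 1 != 0 ->
    (forall b : pred 'I_N, vac_row *m opprod T (filter b (sites N)) *m v = 0) ->
  v = 0.
Proof.
move=> K01 hyp.
suff part m : \col_i (if wt i == m then v i 0 else 0) = 0 :> 'cV[F]_(dH N).
  apply/colP => i; rewrite mxE; have /colP/(_ i) := part (wt i).
  by rewrite !mxE eqxx.
elim/ltn_ind: m => m IH; set w := \col_i _.
apply: (@raising_separation _ _ eta xi eta0 xi_neq xi_neqD (sites N)); first exact: sites_uniq.
move=> b; set t := filter b _.
suff e : vac_row *m opprod B t *m w = 0.
  rewrite vacuum_sites -!mulmxA (mulmxA vac_row).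
  rewrite (_ : opprod _ t = (\prod_(a <- t) K 0 1)^-1 *: opprod B t) ?opprodZ; last first.
    by rewrite scalerK // prodf_seq_neq0; apply/allP.
  by rewrite -scalemxAr -scalemxAl -opprodZ e scaler0 mulmx0.
have [st|st] := eqVneq (size t) m.
  have -> : vac_row *m opprod B t *m w = vac_row *m opprod B t *m v.
    apply/matrixP => i j; rewrite mxE [RHS]mxE; apply: eq_bigr => k _; rewrite !ord1 [w _ _]mxE.
    by case: (eqVneq (wt k) m) => // n; rewrite supported_raising ?mul0r // st.
  rewrite -[_ *m opprod B t](subrK (vac_row *m opprod T t)) mulmxDl hyp addr0.
  apply/matrixP => i j; rewrite [LHS]mxE mxE big1 // => k _; rewrite !ord1.
  have [lt|ge] := ltnP (wt k) m; last first.
    by rewrite -opprB mxE supported_lower ?oppr0 ?mul0r // st -leqNgt.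
  by have /colP/(_ k) := IH _ lt; rewrite !mxE eqxx => ->; rewrite mulr0.
apply/matrixP => i j; rewrite [LHS]mxE mxE big1 // => k _; rewrite [w _ _]mxE.
case: (eqVneq (wt k) m) => [e|_]; last by rewrite mulr0.
by rewrite supported_raising ?mul0r // e eq_sym.
Qed.

End Grading.

(** * Change of basis making an off-diagonal entry of the twist nonzero *)

Section Gauge.
Variables (F : fieldType).
Implicit Types g : 'M[F]_2.

(** Conjugation [g' X g] in the auxiliary space, inverse to the conjugation by [g] on the sites. *)
Definition gauge D (g g' : 'M[F]_2) (X : 'I_2 -> 'I_2 -> 'M[F]_D) : 'I_2 -> 'I_2 -> 'M[F]_D :=
  fun i j => \sum_p \sum_q (g' i p * g q j) *: X p q.

Lemma gauge_bmul D g g' (X Y : 'I_2 -> 'I_2 -> 'M[F]_D) i j : g *m g' = 1%:M ->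
  bmul (gauge g g' X) (gauge g g' Y) i j = gauge g g' (bmul X Y) i j.
Proof.
move=> e.
have er q r : \sum_p g q p * g' p r = (q == r)%:R by have /matrixP/(_ q r) := e; rewrite !mxE.
rewrite /bmul /gauge.
transitivity (\sum_r \sum_p \sum_q \sum_p' \sum_q' ((g' i p * g q' j) * (g q r * g' r p')) *: (X p q *m Y p' q')).
  apply: eq_bigr => r _; rewrite mulmx_suml; apply: eq_bigr => p _.
  rewrite mulmx_suml; apply: eq_bigr => q _; rewrite mulmx_sumr; apply: eq_bigr => p' _.
  rewrite mulmx_sumr; apply: eq_bigr => q' _.
  by rewrite -scalemxAl -scalemxAr scalerA; congr (_ *: _); ring.
rewrite exchange_big; apply: eq_bigr => p _.
transitivity (\sum_q' \sum_q \sum_p' \sum_r ((g' i p * g q' j) * (g q r * g' r p')) *: (X p q *m Y p' q')).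
  rewrite [RHS]exchange_big [LHS]exchange_big; apply: eq_bigr => q _ /=.
  rewrite [RHS]exchange_big [LHS]exchange_big; apply: eq_bigr => p' _ /=.
  exact: exchange_big.
apply: eq_bigr => q' _; rewrite scaler_sumr; apply: eq_bigr => q _.
rewrite (bigD1 q) //= [X in _ + X]big1 ?addr0.
  by rewrite -scaler_suml -mulr_sumr er eqxx mulr1.
by move=> p' np; rewrite -scaler_suml -mulr_sumr er eq_sym (negbTE np) mulr0 scale0r.
Qed.

(** The permutation commutes with g (x) g, so conjugation on the site can be traded for the inverse
    conjugation in the auxiliary space. *)
Lemma gauge_lax eta mu g g' i j : g *m g' = 1%:M -> g' *m g = 1%:M ->
  g *m lax eta mu i j *m g' = gauge g g' (lax eta mu) i j.
Proof.
move=> e e'; have eD k l : (g *m g') k l = (g' *m g) k l by rewrite e e'.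
rewrite /gauge /lax !sum2 mulmxDr mulmxDl mul_mx_scalar -scalemxAl e.
have -> : (mu *+ (i == j)) *: 1%:M = (mu * (g' *m g) i j)%:M :> 'M_2.
  by rewrite e' mxE scalemx1 mulr_natr.
apply/matrixP => a b; rewrite !mxE !sum2 !mxE !sum2 !mxE.
case: (ord2P i) (ord2P j) (ord2P a) (ord2P b) => -> [] -> [] -> [] ->;
 rewrite /eq_op /= ?mulr1n ?mulr0n; ring.
Qed.

Lemma gauge_id D g g' i j : g' *m g = 1%:M ->
  gauge g g' (fun i j => (i == j)%:R%:M : 'M[F]_D) i j = (i == j)%:R%:M.
Proof.
move=> e; rewrite /gauge; transitivity ((\sum_p g' i p * g p j)%:M : 'M[F]_D).
  rewrite raddf_sum; apply: eq_bigr => p _; rewrite (bigD1 p) //= eqxx big1 ?addr0 ?scalemx1 //.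
  by move=> q; rewrite eq_sym => /negbTE->; rewrite raddf0 scaler0.
by have /matrixP/(_ i j) := e; rewrite !mxE => ->.
Qed.

(** Cyclicity of the auxiliary trace: tr (K g' X g) = tr (g K g' X). *)
Lemma twist_gauge D K g g' (X : 'I_2 -> 'I_2 -> 'M[F]_D) :
  twist K (gauge g g' X) = twist (g *m K *m g') X.
Proof.
rewrite !twistE /gauge !sum2; apply/matrixP => a b.
move: (X 0 0) (X 0 1) (X 1 0) (X 1 1) => X0 X1 X2 X3.
rewrite !mxE !sum2 !mxE !sum2; ring.
Qed.

Variables (N : nat) (eta : F) (xi : 'I_N -> F).

Lemma gauge_chain g g' s l i j : g *m g' = 1%:M -> g' *m g = 1%:M ->
  tensor (fun=> g) *m chain eta xi s l i j *m tensor (fun=> g') = gauge g g' (chain eta xi s l) i j.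
Proof.
move=> e e'.
have T1 h h' : h *m h' = 1%:M -> tensor (fun=> h) *m tensor (fun=> h') = 1%:M :> 'M[F]_(dH N).
  by move=> eh; rewrite tensorM -tensor1; apply: eq_tensor.
have loc n mu k p : tensor (fun=> g) *m Lop eta n mu k p *m tensor (fun=> g') =
    gauge g g' (Lop eta n mu) k p.
  rewrite site_conj // gauge_lax // /gauge !sum2 !siteD !siteZ //.
elim: s i j => [|n s IH] i j.
  by rewrite gauge_id // mul_mx_scalar -scalemxAl T1 // scalemx1.
rewrite chain_cons -gauge_bmul // /bmul mulmx_sumr mulmx_suml; apply: eq_bigr => p _.
rewrite -IH -loc -!mulmxA; do 2!congr (_ *m _).
by rewrite (mulmxA (tensor _) (tensor _)) T1 // mul1mx.
Qed.

Lemma transfer_gauge K g g' l : g *m g' = 1%:M -> g' *m g = 1%:M ->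
  tensor (fun=> g) *m transfer eta K xi l *m tensor (fun=> g') = transfer eta (g *m K *m g') xi l.
Proof.
move=> e e'; rewrite /transfer -twist_gauge /twist mulmx_sumr mulmx_suml.
apply: eq_bigr => p _; rewrite -scalemxAr -scalemxAl; congr (_ *: _).
exact: gauge_chain.
Qed.

(** Three cases: [K 0 1] is already nonzero; the swap of basis vectors brings [K 1 0] there; for
    diagonal [K] a shear produces [K 1 1 - K 0 0], nonzero because [K] is not scalar. *)
Lemma nonscalar_gauge (K : 'M[F]_2) : (forall c : F, K != c%:M) ->
  exists g g', [/\ g *m g' = 1%:M, g' *m g = 1%:M & (g *m K *m g') 0 1 != 0].
Proof.
move=> nK; have [K01|K01] := eqVneq (K 0 1) 0; last first.
  by exists 1%:M, 1%:M; rewrite !mulmx1 mul1mx.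
have [K10|K10] := eqVneq (K 1 0) 0; last first.
  pose d : 'M[F]_2 := delta_mx 0 1 + delta_mx 1 0.
  have sw : d *m d = 1%:M.
    apply/matrixP => i j; rewrite !mxE sum2 !mxE.
    by case: (ord2P i) (ord2P j) => -> [] -> /=; ring.
  exists d, d; split=> //.
  by rewrite !mxE !sum2 !mxE !sum2 !mxE /= K01 !(mulr0, mul0r, add0r, addr0, mulr1, mul1r).
exists (1%:M + delta_mx 0 1), (1%:M - delta_mx 0 1); split.
- by rewrite mulmxBr mulmxDl mul1mx !mulmx1 mulmxDl mul1mx mul_delta_mx_0 // addr0 addrK.
- by rewrite mulmxDr mulmxBl mul1mx !mulmx1 mulmxBl mul1mx mul_delta_mx_0 // subr0 subrK.
rewrite !mxE !sum2 !mxE !sum2 !mxE /= K01 K10.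
rewrite !(mulr0, mul0r, add0r, addr0, mulr1, mul1r, subr0, sub0r, mulrN1).
apply: contra (nK (K 1 1)) => /eqP e; apply/eqP/matrixP => i j; rewrite mxE.
case: (ord2P i) (ord2P j) => -> [] ->; rewrite ?K01 ?K10 ?mulr0n ?mulr1n //.
by move/eqP: e; rewrite addrC subr_eq0 => /eqP.
Qed.

Hypothesis eta0 : eta != 0.
Hypothesis xi_neq : forall a b, a != b -> xi a != xi b.
Hypothesis xi_neqD : forall a b, a != b -> xi a - xi b + eta != 0.

Lemma exists_separating_covector K : (forall c : F, K != c%:M) ->
  exists S : 'rV[F]_(dH N), forall v : 'cV[F]_(dH N),
    (forall b : pred 'I_N,
       S *m opprod (fun a => transfer eta K xi (xi a)) (filter b (sites N)) *m v = 0) ->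
    v = 0.
Proof.
move=> /nonscalar_gauge[g [g' [e e' K01]]].
pose G : 'M[F]_(dH N) := tensor (fun=> g); pose G' : 'M[F]_(dH N) := tensor (fun=> g').
have GG' : G *m G' = 1%:M by rewrite tensorM -tensor1; apply: eq_tensor.
have G'G : G' *m G = 1%:M by rewrite tensorM -tensor1; apply: eq_tensor.
(* For this covector the hypothesis on [v] becomes that of [transfer_separation] for the conjugated
   twist and the vector [G *m v]. *)
exists (vac_row F N *m G) => v hyp.
rewrite -[v]mul1mx -G'G -mulmxA.
rewrite (transfer_separation eta0 xi_neq xi_neqD K01 (v := G *m v)) ?mulmx0 // => b.
rewrite -[RHS](hyp b) !mulmxA -(mulmxA _ _ G).
suff -> : opprod (fun a => transfer eta (g *m K *m g') xi (xi a)) (filter b (sites N)) *m G =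
  G *m opprod (fun a => transfer eta K xi (xi a)) (filter b (sites N)) by rewrite mulmxA.
elim: (filter _ _) => [|a t IH] /=; first by rewrite mul1mx mulmx1.
by rewrite -mulmxA IH -transfer_gauge // mulmxA -(mulmxA _ G' G) G'G mulmx1 -mulmxA.
Qed.

End Gauge.

(** * Dependence on the spectral parameter *)

Section Degree.
Variable F : fieldType.
Implicit Types (f : F -> F) (c : F) (n : nat).

(** [c] is the coefficient of degree exactly [n], possibly zero. *)
Definition poly_fun n c f := exists p : {poly F},
  [/\ (size p <= n.+1)%N, p`_n = c & forall l, f l = p.[l]].

Lemma poly_fun_ext n c f f' : (forall l, f l = f' l) -> poly_fun n c f -> poly_fun n c f'.
Proof. by move=> e [p [s cp h]]; exists p; split=> // l; rewrite -e. Qed.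

Lemma poly_fun_cst c : poly_fun 0 c (fun=> c).
Proof. by exists c%:P; split=> [||l]; rewrite ?size_polyC_leq1 ?coefC ?hornerC. Qed.

Lemma poly_funD n c c' f f' : poly_fun n c f -> poly_fun n c' f' ->
  poly_fun n (c + c') (fun l => f l + f' l).
Proof.
move=> [p [s <- h]] [q [s' <- h']]; exists (p + q); split=> [||l]; rewrite ?coefD ?hornerD ?h ?h' //.
by rewrite (leq_trans (size_polyD _ _)) // geq_max s s'.
Qed.

Lemma poly_fun0 n : poly_fun n 0 (fun=> 0).
Proof. by exists 0; split=> [||l]; rewrite ?size_poly0 ?coef0 ?horner0. Qed.

Lemma poly_fun_sum n (I : Type) (r : seq I) (c : I -> F) (f : I -> F -> F) :
  (forall i, poly_fun n (c i) (f i)) ->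
  poly_fun n (\sum_(i <- r) c i) (fun l => \sum_(i <- r) f i l).
Proof.
move=> h; elim: r => [|i r IH].
  by rewrite big_nil; apply: poly_fun_ext (poly_fun0 n) => l; rewrite big_nil.
rewrite big_cons; apply: poly_fun_ext (poly_funD (h i) IH) => l.
by rewrite big_cons.
Qed.

Lemma poly_funZ n a c f : poly_fun n c f -> poly_fun n (a * c) (fun l => a * f l).
Proof.
move=> [p [s <- h]]; exists (a *: p); split=> [||l]; rewrite ?coefZ ?hornerZ ?h //.
exact: leq_trans (size_scale_leq _ _) s.
Qed.

Lemma poly_fun_mulX n c x f : poly_fun n c f -> poly_fun n.+1 c (fun l => (l - x) * f l).
Proof.
move=> [p [s <- h]]; exists (('X - x%:P) * p); split=> [||l].
- by rewrite (leq_trans (size_polyMleq _ _)) // size_XsubC.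
- by rewrite mulrBl coefB coefXM coefCM /= [p`_n.+1]nth_default // mulr0 subr0.
by rewrite hornerM hornerXsubC h.
Qed.

Lemma poly_fun_weak m n c f : (m < n)%N -> poly_fun m c f -> poly_fun n 0 f.
Proof.
move=> mn [p [s _ h]]; exists p; split=> //; first by apply: leq_trans s _; rewrite ltnS ltnW.
by rewrite nth_default // (leq_trans s).
Qed.

(** The common coefficient [c] brings the difference below degree [n], so [n] nodes suffice instead
    of n + 1. *)
Lemma poly_fun_inj n c f f' (y : 'I_n -> F) : injective y ->
  poly_fun n c f -> poly_fun n c f' -> (forall a, f (y a) = f' (y a)) -> forall l, f l = f' l.
Proof.
move=> yi [p [s <- h]] [q [s' e h']] eqy l; rewrite h h'.
suff -> : p = q by [].
apply/eqP; rewrite -subr_eq0; apply/negPn/negP => nz.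
have := @max_poly_roots _ (p - q) (map y (enum 'I_n)) nz.
rewrite size_map size_enum_ord map_inj_uniq ?enum_uniq // => /(_ _ isT).
have -> : all (root (p - q)) [seq y i | i <- enum 'I_n].
  apply/allP => _ /mapP[a _ ->]; by rewrite rootE hornerD hornerN -h -h' eqy subrr.
move=> /(_ isT); rewrite ltnNge => /negP; apply.
apply/leq_sizeP => j; rewrite leq_eqVlt coefB => /orP[/eqP<-|nj]; first by rewrite e subrr.
by rewrite !nth_default ?subrr // (leq_trans _ nj).
Qed.

Lemma poly_fun_prod (I : Type) (r : seq I) (x k : I -> F) :
  poly_fun (size r) (\prod_(i <- r) k i) (fun l => \prod_(i <- r) ((l - x i) * k i)).
Proof.
elim: r => [|i r IH] /=.
  by rewrite big_nil; apply: poly_fun_ext (poly_fun_cst 1) => l; rewrite big_nil.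
rewrite big_cons; apply: poly_fun_ext (poly_fun_mulX (x i) (poly_funZ (k i) IH)) => l.
by rewrite big_cons mulrA.
Qed.

End Degree.

(** * Degree of the transfer matrix and Lagrange interpolation *)

Section Assembly.
Variables (F : fieldType) (N : nat) (eta : F) (K : 'M[F]_2) (xi : 'I_N -> F).

(** Each site contributes (l - xi_n) times the identity block plus a term constant in [l], so the
    top coefficient comes from the identity blocks alone. *)
Lemma poly_fun_chain s i j k k' :
  poly_fun (size s) (((i == j)%:R%:M : 'M[F]_(dH N)) k k') (fun l => chain eta xi s l i j k k').
Proof.
elim: s i j k k' => [|n s IH] i j k k'; first exact: poly_fun_cst.
have e l : chain eta xi (n :: s) l i j k k' = (l - xi n) * chain eta xi s l i j k k' +
    eta * \sum_p \sum_q site n (delta_mx p i) k q * chain eta xi s l p j q k'.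
  rewrite chain_cons /bmul (eq_bigr (fun p => ((l - xi n) *+ (i == p)) *: chain eta xi s l p j
    + eta *: (site n (delta_mx p i) *m chain eta xi s l p j))); last first.
    by move=> p _; rewrite /Lop /lax siteD siteZ site_scalar mulmxDl mul_scalar_mx -scalemxAl.
  rewrite big_split /= mxE; congr (_ + _).
    rewrite (bigD1 i) //= eqxx mulr1n big1 ?addr0 ?mxE // => p; rewrite eq_sym => /negbTE->.
    by rewrite mulr0n scale0r.
  by rewrite -scaler_sumr mxE summxE; congr (_ * _); apply: eq_bigr => p _; rewrite mxE.
apply: poly_fun_ext (fun l => esym (e l)) _; rewrite -[X in poly_fun _ X]addr0.
apply: poly_funD; first exact: poly_fun_mulX.
apply: (@poly_fun_weak _ (size s) _ (eta * \sum_p \sum_q site n (delta_mx p i) k q * ((p == j)%:R%:M : 'M[F]_(dH N)) q k')) => //.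
by apply/poly_funZ/poly_fun_sum => p; apply/poly_fun_sum => q; apply/poly_funZ.
Qed.

Lemma poly_fun_transfer k k' :
  poly_fun N (\tr K * (k == k')%:R) (fun l => transfer eta K xi l k k').
Proof.
have e l : transfer eta K xi l k k' =
    \sum_(p : 'I_2 * 'I_2) K p.2 p.1 * chain eta xi (sites N) l p.1 p.2 k k'.
  by rewrite /transfer /twist summxE; apply: eq_bigr => p _; rewrite mxE.
apply: poly_fun_ext (fun l => esym (e l)) _.
have -> : \tr K * (k == k')%:R =
    \sum_(p : 'I_2 * 'I_2) K p.2 p.1 * ((p.1 == p.2)%:R%:M : 'M[F]_(dH N)) k k'.
  rewrite -(pair_bigA _ (fun i j => K j i * ((i == j)%:R%:M : 'M[F]_(dH N)) k k')) /=.
  rewrite /mxtrace mulr_suml; apply: eq_bigr => i _.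
  rewrite (bigD1 i) //= eqxx [X in _ + X]big1 ?addr0 ?mxE // => j.
  by rewrite eq_sym => /negbTE->; rewrite raddf0 mxE mulr0.
apply: poly_fun_sum => p; apply: poly_funZ.
by have := @poly_fun_chain (sites N) p.1 p.2 k k'; rewrite size_rev size_enum_ord.
Qed.

(** This is [tfun] over a general field. *)
Definition interpolant (x : 'I_N -> F) l :=
  \tr K * \prod_a (l - xi a) + \sum_a (\prod_(b | b != a) ((l - xi b) / (xi a - xi b))) * x a.

Lemma poly_fun_interpolant x : poly_fun N (\tr K) (interpolant x).
Proof.
rewrite -[\tr K]addr0; apply: poly_funD.
  rewrite -[X in poly_fun _ X]mulr1; apply: poly_funZ.
  have := poly_fun_prod (enum 'I_N) xi (fun=> 1); rewrite size_enum_ord big1 //.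
  by apply: poly_fun_ext => l; rewrite big_enum; apply: eq_bigr => a _; rewrite mulr1.
(* Each Lagrange term has only N - 1 linear factors, hence coefficient 0 in degree N. *)
rewrite [X in poly_fun N X](_ : 0 = \sum_(a : 'I_N) 0); last by rewrite big1.
apply: poly_fun_sum => a; rewrite -(mulr0 (x a)).
apply: (@poly_fun_ext _ _ _ (fun l => x a * \prod_(b | b != a) ((l - xi b) / (xi a - xi b)))).
  by move=> l; rewrite mulrC.
apply: poly_funZ; have := poly_fun_prod (filter (predC1 a) (enum 'I_N)) xi (fun b => (xi a - xi b)^-1).
move=> /(@poly_fun_weak _ _ N) /=; rewrite size_filter.
have cnt : (count (predC1 a) (enum 'I_N) < N)%N.
  rewrite -[X in (_ < X)%N]size_enum_ord -(count_predC (pred1 a) (enum 'I_N)).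
  by rewrite -[X in (X < _)%N]add0n ltn_add2r -has_count has_pred1 mem_enum.
move=> /(_ cnt); apply: poly_fun_ext => l.
by rewrite big_filter big_enum_cond.
Qed.

Hypothesis xi_neq : forall a b, a != b -> [/\ xi a != xi b - eta, xi a != xi b & xi a != xi b + eta].

Lemma xi_inj : injective xi.
Proof. by move=> a b e; apply/eqP; apply: contraT => /xi_neq[_]; rewrite e eqxx. Qed.

Lemma interpolant_node x n : interpolant x (xi n) = x n.
Proof.
rewrite /interpolant (bigD1 n) //= subrr mul0r mulr0 add0r.
rewrite (bigD1 n) //= big1 => [|b bn]; last by rewrite divff // subr_eq0 (inj_eq xi_inj) eq_sym.
rewrite mul1r big1 ?addr0 // => a an.
by rewrite (bigD1 n) 1?eq_sym //= subrr !mul0r.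
Qed.

Lemma interpolant_unique t : poly_fun N (\tr K) t -> forall l, t l = interpolant (fun a => t (xi a)) l.
Proof.
move=> pt; apply: poly_fun_inj xi_inj pt (poly_fun_interpolant _) _ => a.
by rewrite interpolant_node.
Qed.

End Assembly.

(** * Covector basis and eigenvectors *)

Section Covectors.
Variables (F : fieldType) (N : nat) (eta : F) (K : 'M[F]_2) (xi : 'I_N -> F).
Hypothesis eta0 : eta != 0.
Hypothesis xi_neq : forall a b, a != b -> [/\ xi a != xi b - eta, xi a != xi b & xi a != xi b + eta].
Implicit Types (S : 'rV[F]_(dH N)) (v : 'cV[F]_(dH N)) (h : cfg N) (x : 'I_N -> F).

Local Notation T := (transfer eta K xi).

Definition alpha n := \prod_b (xi n + eta - xi b).

Lemma alpha_neq0 n : alpha n != 0.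
Proof.
apply/prodf_neq0 => b _; have [->|/xi_neq[ne _ _]] := eqVneq n b.
  by rewrite addrAC subrr add0r.
by rewrite subr_eq0 eq_sym -subr_eq eq_sym.
Qed.

Definition nodeop n := (alpha n)^-1 *: T (xi n).

(** For distinct nodes the difference xi_a - xi_b is neither eta nor -eta, which is what
    [transfer_comm] requires. *)
Lemma nodeop_comm a b : nodeop a *m nodeop b = nodeop b *m nodeop a.
Proof.
have [->//|/xi_neq[e1 _ e2]] := eqVneq a b.
rewrite /nodeop -!scalemxAl -!scalemxAr transfer_comm; first by rewrite !scalerA mulrC.
by rewrite eq_sym eqf_sqr negb_or !subr_eq ![_ + xi b]addrC e1 e2.
Qed.

Definition covector S h := S *m opprod nodeop [seq a <- enum 'I_N | h a != 0].

Definition covector_mx S : 'M[F]_(dH N) := \matrix_i covector S (enum_val i : cfg N).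

Definition set_up h n : cfg N := [ffun m => if m == n then 1 else h m].

(** Commutation of the [nodeop] lets the new factor, whose place is inside the ordered product,
    stand at its end. *)
Lemma covector_set_up S h n : h n = 0 -> covector S (set_up h n) = covector S h *m nodeop n.
Proof.
move=> hn; rewrite /covector -mulmxA -opprod_rcons; congr (_ *m _).
apply: perm_opprod; first exact: nodeop_comm.
apply: uniq_perm; first by rewrite filter_uniq // enum_uniq.
  by rewrite rcons_uniq filter_uniq ?enum_uniq // mem_filter hn eqxx.
move=> m; rewrite mem_filter mem_enum mem_rcons in_cons mem_filter mem_enum !andbT ffunE.
by case: (eqVneq m n).
Qed.

Definition sov_coord x h := \prod_n (x n / alpha n) ^+ h n.

Lemma sov_coord_set_up x h n : h n = 0 -> sov_coord x (set_up h n) = sov_coord x h * (x n / alpha n).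
Proof.
move=> hn; rewrite /sov_coord (bigD1 n) //= [X in _ = X * _](bigD1 n) //= hn ffunE eqxx.
rewrite expr0 expr1 mul1r mulrC; congr (_ * _); apply: eq_bigr => m /negbTE mn.
by rewrite ffunE mn.
Qed.

Lemma covector_eigen S x v h : (forall a, T (xi a) *m v = x a *: v) ->
  covector S h *m v = sov_coord x h *: (S *m v).
Proof.
move=> ev; have -> : sov_coord x h = \prod_(a <- [seq a <- enum 'I_N | h a != 0]) (x a / alpha a).
  rewrite big_filter big_enum_cond /sov_coord (bigID (fun a => h a != 0)) /=.
  rewrite [X in _ * X]big1 ?mulr1 => [|a /negPn/eqP->]; last by rewrite expr0.
  by apply: eq_bigr => a; case: (ord2P (h a)) => ->; rewrite ?eqxx ?expr1.
rewrite /covector -mulmxA scalemxAr; congr (_ *m _).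
elim: (filter _ _) => [|a t IH] /=; first by rewrite mul1mx big_nil scale1r.
rewrite -mulmxA IH -scalemxAr /nodeop -scalemxAl ev !scalerA big_cons.
by congr (_ *: _); ring.
Qed.

(** Up to the factor <S|v>, the coordinates of an eigenvector depend only on its eigenvalue; both
    simplicity and the product formula follow. *)
Lemma covector_mx_eigen S x v : (forall a, T (xi a) *m v = x a *: v) ->
  covector_mx S *m v = (S *m v) 0 0 *: \col_i sov_coord x (enum_val i).
Proof.
move=> ev; apply/colP => i; have := covector_eigen S (enum_val i) ev => /matrixP/(_ 0 0).
by rewrite [RHS]mxE !(mxE, ord1) mulrC => <-; apply: eq_bigr => k _; rewrite mxE.
Qed.

Lemma exists_covector_basis : (forall c : F, K != c%:M) -> exists S, covector_mx S \in unitmx.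
Proof.
move=> nK; have xi1 a b : a != b -> xi a != xi b by case/xi_neq.
have xi2 a b : a != b -> xi a - xi b + eta != 0.
  by case/xi_neq => e _ _; rewrite addrAC subr_eq0 eq_sym -subr_eq eq_sym.
have [S sep] := exists_separating_covector eta0 xi1 xi2 nK.
(* Transposing turns a kernel row into a vector annihilated by every covector, to which the
   separation property of [S] applies. *)
exists S; rewrite -unitmx_tr -row_free_unit -kermx_eq0; apply/eqP/row_matrixP => i.
set r := row i _; have : r *m (covector_mx S)^T = 0 by rewrite -row_mul mulmx_ker row0.
rewrite row0 => /(congr1 trmx); rewrite trmx_mul trmxK trmx0 => z.
suff : r^T = 0 by move/(congr1 trmx); rewrite trmxK trmx0.
apply: sep => b; set t := filter b _.
pose h : cfg N := [ffun a => if b a then 1 else 0].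
have /colP/(_ (enum_rank h)) := z; rewrite mxE [RHS]mxE => zh.
have {zh}zh : covector S h *m r^T = 0.
  by apply/matrixP => j k; rewrite !ord1 [RHS]mxE -[RHS]zh mxE; apply: eq_bigr => q _; rewrite [in RHS]mxE enum_rankK !mxE.
have e : opprod nodeop [seq a <- enum 'I_N | h a != 0] = opprod nodeop t.
  apply: perm_opprod; first exact: nodeop_comm.
  apply: uniq_perm; [exact/filter_uniq/enum_uniq | exact/filter_uniq/sites_uniq | move=> m].
  by rewrite mem_filter mem_enum [RHS]mem_filter mem_sites !andbT ffunE; case: (b m).
move: zh; rewrite /covector e /nodeop opprodZ -scalemxAr -scalemxAl => /eqP.
rewrite scaler_eq0 prodf_seq_eq0; case: hasP => [[a _]|_ /eqP//].
by rewrite /= invr_eq0 (negbTE (alpha_neq0 _)).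
Qed.

Definition bethe_system x := forall n,
  x n * interpolant K xi x (xi n - eta) = alpha n * \prod_b (xi n - eta - xi b) * \det K.

Lemma transfer_fusion_alpha n : T (xi n) *m T (xi n - eta) =
  (alpha n * \prod_b (xi n - eta - xi b) * \det K)%:M.
Proof.
rewrite transfer_fusion mulrC; congr (_ * _ * _)%:M; apply: eq_bigr => b _; exact: addrAC.
Qed.

Lemma eigenvalue_poly_fun t v : v != 0 -> (forall l, T l *m v = t l *: v) ->
  poly_fun N (\tr K) t.
Proof.
(* The eigenvalue is read off at a nonzero coordinate of [v], as a fixed linear combination of
   entries of [T l]. *)
move=> v0 ev; have [i vi] : exists i, v i 0 != 0.
  by apply/existsP; apply: contraNT v0 => /existsPn z; apply/eqP/colP => i; rewrite mxE; apply/eqP/negPn.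
have e l : (v i 0)^-1 * \sum_k v k 0 * T l i k = t l.
  have /colP/(_ i) := ev l; rewrite !mxE.
  by under eq_bigr do rewrite mulrC; move=> ->; rewrite mulrCA mulVf ?mulr1.
apply: poly_fun_ext e _.
have -> : \tr K = (v i 0)^-1 * \sum_k v k 0 * (\tr K * (i == k)%:R).
  rewrite (bigD1 i) //= eqxx big1 ?addr0 ?mulr1 => [|k]; first by rewrite mulKf.
  by rewrite eq_sym => /negbTE->; rewrite !mulr0.
by apply/poly_funZ/poly_fun_sum => k; apply/poly_funZ/poly_fun_transfer.
Qed.

Lemma eigenvalue_interpolant t v : v != 0 -> (forall l, T l *m v = t l *: v) ->
  bethe_system (fun a => t (xi a)) /\ forall l, t l = interpolant K xi (fun a => t (xi a)) l.
Proof.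
move=> v0 ev; have it := interpolant_unique xi_neq (eigenvalue_poly_fun v0 ev); split=> // n.
rewrite -it; have := congr1 (mulmx^~ v) (transfer_fusion_alpha n).
rewrite -mulmxA ev -scalemxAr ev scalerA mul_scalar_mx => /eqP.
rewrite -subr_eq0 -scalerBl scaler_eq0 (negbTE v0) orbF subr_eq0 mulrC => /eqP //.
Qed.

Lemma system_eigenvector S x : covector_mx S \in unitmx -> bethe_system x ->
  exists2 v : 'cV[F]_(dH N), v != 0 & forall l, T l *m v = interpolant K xi x l *: v.
Proof.
move=> US sys; set t := interpolant K xi x.
pose v := invmx (covector_mx S) *m \col_i sov_coord x (enum_val i : cfg N).
have cv h : (covector S h *m v) 0 0 = sov_coord x h.
  have /colP/(_ (enum_rank h)) : covector_mx S *m v = \col_i sov_coord x (enum_val i : cfg N).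
    by rewrite mulKVmx.
  rewrite !mxE enum_rankK => <-; apply: eq_bigr => k _.
  by rewrite [covector_mx _ _ _]mxE enum_rankK.
exists v.
  (* The coordinate at the all-zero configuration is an empty product, equal to 1, so [v] cannot
     vanish. *)
  apply/eqP => v0; have := cv [ffun=> 0]; rewrite v0 mulmx0 mxE /sov_coord big1.
    by move/eqP; rewrite eq_sym oner_eq0.
  by move=> n _; rewrite ffunE expr0.
move=> l; apply: (can_inj (mulKmx US)); apply/colP => i.
set h : cfg N := enum_val i.
have rowE w : (covector_mx S *m w) i 0 = (covector S h *m w) 0 0.
  by rewrite !mxE; apply: eq_bigr => k _; rewrite mxE.
rewrite !rowE -scalemxAr [RHS]mxE cv.
(* The interpolation nodes depend on [h]; the separation of the xi_a up to shifts by eta makes them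
   distinct. *)
pose y n := if h n == 0 then xi n else xi n - eta.
have yi : injective y.
  move=> a b; apply: contra_eq => /xi_neq[e1 e2 e3]; rewrite /y.
  case: (h a == 0); case: (h b == 0) => //; first by rewrite subr_eq.
  by rewrite (inj_eq (addIr _)).
apply: (poly_fun_inj (c := \tr K * sov_coord x h) (f := fun l => (covector S h *m (T l *m v)) 0 0)
   (f' := fun l => t l * sov_coord x h) yi).
- apply: (@poly_fun_ext _ _ _ (fun l => \sum_k \sum_k' (covector S h 0 k * v k' 0) * T l k k')).
    move=> m; rewrite mxE; apply: eq_bigr => k _; rewrite [X in _ = _ * X]mxE mulr_sumr.
    by apply: eq_bigr => k' _; ring.
  have -> : \tr K * sov_coord x h = \sum_k \sum_k' (covector S h 0 k * v k' 0) * (\tr K * (k == k')%:R).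
    rewrite -cv mxE mulr_sumr; apply: eq_bigr => k _.
    rewrite (bigD1 k) //= eqxx big1 ?addr0 ?mulr1 => [|k']; first by rewrite mulrC.
    by rewrite eq_sym => /negbTE->; rewrite !mulr0.
  by apply/poly_fun_sum => k; apply/poly_fun_sum => k'; apply/poly_funZ/poly_fun_transfer.
- rewrite mulrC; apply: (@poly_fun_ext _ _ _ (fun l => sov_coord x h * t l)) => [m|]; first exact: mulrC.
  exact/poly_funZ/poly_fun_interpolant.
move=> n; rewrite /y; have an := alpha_neq0 n; have [hn|hn] := eqVneq (h n) 0.
  rewrite mulmxA (_ : covector S h *m T (xi n) = alpha n *: covector S (set_up h n)); last first.
    by rewrite covector_set_up // /nodeop -scalemxAr scalerA divff ?scale1r.
  rewrite -scalemxAl mxE cv sov_coord_set_up // /t (interpolant_node _ xi_neq).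
  by field.
(* For h_n = 1 the covector is that of [h0] times the operator at xi_n. Fusion reduces its product
   with [T (xi n - eta)] to a scalar, which the n-th equation of the system rewrites as x_n t(xi_n -
   eta). *)
pose h0 : cfg N := [ffun m => if m == n then 0 else h m].
have h0n : h0 n = 0 by rewrite ffunE eqxx.
have eh : h = set_up h0 n.
  apply/ffunP => m; rewrite !ffunE; case: eqVneq => // ->.
  by case: (ord2P (h n)) hn => ->.
rewrite eh covector_set_up // sov_coord_set_up // -mulmxA /nodeop -scalemxAl.
rewrite [T _ *m _]mulmxA transfer_fusion_alpha mul_scalar_mx scalerA -scalemxAr mxE cv.
by rewrite -sys /t; ring.
Qed.

End Covectors.

(** * Identification with the complex operators and covectors of the statement *)

Lemma foldl_iter_opprod (F : fieldType) (N D : nat) (Y : 'I_N -> 'M[F]_D) (h : cfg N) t (S : 'rV[F]_D) :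
  foldl (fun acc a => iter (h a) (fun r => r *m Y a) acc) S t =
  S *m opprod Y [seq a <- t | h a != 0].
Proof.
elim: t S => [|a t IH] S /=; first by rewrite mulmx1.
by rewrite IH; case: (ord2P (h a)) => -> //=; rewrite mulmxA.
Qed.

Section Identification.
Variables (N : nat) (eta : C) (K : 'M[C]_2) (xi : 'I_N -> C).

Lemma TK_fun : TK eta K xi = transfer eta K xi.
Proof. by apply: functional_extensionality => l; apply: TK_transfer. Qed.

Lemma covec_covector S h : covec eta K xi S h = covector eta K xi S h.
Proof. by rewrite /covec TK_fun; apply: foldl_iter_opprod. Qed.

Lemma covec_basisE S : covec_basis eta K xi S <-> covector_mx eta K xi S \in unitmx.
Proof.
have e : \matrix_(i < dH N) covec eta K xi S (enum_val i : cfg N) = covector_mx eta K xi S.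
  by apply/row_matrixP => i; rewrite !rowK covec_covector.
by rewrite /covec_basis e row_free_unit row_full_unit; split=> [[]|].
Qed.

Lemma SigmaT_system x : SigmaT eta K xi x <-> bethe_system eta K xi x.
Proof.
have e n : \tr K * \prod_(a < N) (xi n - xi a - eta) + \sum_(a < N) gfun xi a (xi n - eta) * x a =
    interpolant K xi x (xi n - eta).
  by congr (_ * _ + _); apply: eq_bigr => a _; apply: addrAC.
by split=> sys n; have := sys n; rewrite e.
Qed.

End Identification.

Theorem theorem3p1 (N : nat) (eta : C) (K : 'M[C]_2) (xi : 'I_N -> C) :
  (0 < N)%N ->
  eta != 0 ->
  (forall alpha : C, K != alpha%:M) ->
  (forall a b : 'I_N, a != b ->
     [/\ xi a != xi b - eta, xi a != xi b & xi a != xi b + eta]) ->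
  [/\ (* the spectrum *)
      (forall t : C -> C,
         is_eigval eta K xi t <-> exists2 x, SigmaT eta K xi x & t = tfun K xi x),
      (* w-simplicity *)
      wsimple eta K xi
    & (* the eigenvectors in the covector basis *)
      forall S : 'rV[C]_(dH N), covec_basis eta K xi S ->
      forall t : C -> C, is_eigval eta K xi t ->
        exists v : 'cV[C]_(dH N),
          [/\ eigvec eta K xi v t,
              pairing S v = 1,
              (forall w, eigvec eta K xi w t -> pairing S w = 1 -> w = v)
            & forall h : cfg N,
                pairing (covec eta K xi S h) v
                = \prod_(n < N) (t (xi n) / afun eta xi (xi n)) ^+ h n]].
Proof.
move=> _ eta0 nK xi_neq.
have [S0 US0] := exists_covector_basis eta0 xi_neq nK.
have coords S v t : eigvec eta K xi v t ->
    covector_mx eta K xi S *m v =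
    (S *m v) 0 0 *: \col_i sov_coord eta xi (fun a => t (xi a)) (enum_val i : cfg N).
  by rewrite /eigvec TK_fun => -[_ ev]; apply: covector_mx_eigen.
(* If <S|v> were 0, all coordinates of [v] in the covector basis would vanish. *)
have scal S v t : covector_mx eta K xi S \in unitmx -> eigvec eta K xi v t -> (S *m v) 0 0 != 0.
  move=> US ev; apply/eqP => z; have := coords S v t ev.
  rewrite z scale0r => /(congr1 (mulmx (invmx (covector_mx eta K xi S)))).
  by rewrite mulKmx // mulmx0 => v0; case: ev; rewrite v0 eqxx.
(* Two eigenvectors for the same [t] have proportional coordinates, with ratio <S|w> / <S|v>. *)
have determined S v w t : covector_mx eta K xi S \in unitmx ->
    eigvec eta K xi v t -> eigvec eta K xi w t -> w = ((S *m w) 0 0 / (S *m v) 0 0) *: v.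
  move=> US ev ew; apply: (can_inj (mulKmx US)).
  rewrite -scalemxAr (coords _ _ _ ev) (coords _ _ _ ew) scalerA divfK //.
  exact: scal ev.
split.
- move=> t; split=> [[v [v0 ev]]|[x /SigmaT_system sys ->]].
    rewrite TK_fun in ev.
    have [sys it] := eigenvalue_interpolant xi_neq v0 ev.
    exists (fun a => t (xi a)); first exact/SigmaT_system.
    by apply: functional_extensionality => l; apply: it.
  have [v v0 ev] := system_eigenvector eta0 xi_neq US0 sys.
  by exists v; split=> // l; rewrite TK_transfer ev.
- move=> t v w ev ew; exists ((S0 *m w) 0 0 / (S0 *m v) 0 0).
  exact: determined ev ew.
move=> S /covec_basisE US t [w ew].
have wS := scal _ _ _ US ew.
(* Any eigenvector can be normalized, its pairing with [S] being nonzero. *)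
pose v := ((S *m w) 0 0)^-1 *: w.
have Sv : pairing S v = 1 by rewrite /pairing /v -scalemxAr mxE mulVf.
have ev : eigvec eta K xi v t.
  case: ew => w0 ew; split=> [|l]; first by rewrite scaler_eq0 invr_eq0 (negbTE wS).
  by rewrite /v -scalemxAr ew !scalerA mulrC.
exists v; split=> // [u eu Su|h].
  by rewrite (determined _ _ _ _ US ev eu) -!/(pairing _ _) Sv Su divr1 scale1r.
rewrite covec_covector; move: ev Sv; rewrite /eigvec TK_fun /pairing => -[_ ev] Sv.
rewrite (@covector_eigen _ _ _ _ _ S (fun a => t (xi a)) v) //.
by rewrite mxE Sv mulr1.
Qed.
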